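(* Let $\mathcal M$ be a countable MDP with initial state $s_0$, let $\{A_i\}_{i\in\mathbb N}$ be a sequence of sets of transitions of $\mathcal M$ that is monotone decreasing with respect to set inclusion, and consider the objective $\varphi=\bigcap_{i\in\mathbb N}\mathsf F\mathsf G A_i$. If an optimal strategy for $\varphi$ from $s_0$ exists, then an optimal strategy for $\varphi$ from $s_0$ can be chosen (1) memoryless deterministic (MD), if $\mathcal M$ is universally transient; (2) deterministic Markov (Det(SC)) in general (even if $\mathcal M$ is not universally transient).
   Context: An MDP $\mathcal M$ consists of a countable set $S$ of states partitioned into controlled states $S_C$ and random states $S_R$; a transition relation $\longrightarrow\subseteq S\times S$ such that every state has at least one successor (the set $\mathrm{Succ}(s)$ of successors of $s$ may be infinite); and a function $P$ assigning to each random state $s$ a probability distribution on $\mathrm{Succ}(s)$. A run is an infinite sequence $s_0e_0s_1e_1\cdots$ with $e_i=(s_i,s_{i+1})\in\longrightarrow$; a history is a finite prefix of a run ending in a controlled state. A (general) strategy $\sigma$ maps each history ending in $s$ to a probability distribution on $\mathrm{Succ}(s)$. It is deterministic if all these distributions are Dirac; memoryless if they depend only on the current state; Markov if they depend only on the current state and the number of steps taken so far. A strategy and a start state $s$ induce a probability measure $\mathcal P_{\mathcal M,s,\sigma}$ on the Borel $\sigma$-algebra of runs from $s$. For an event $\varphi$, $\mathrm{val}(s)=\sup_\sigma\mathcal P_{\mathcal M,s,\sigma}(\varphi)$ over all strategies; $\sigma$ is optimal for $\varphi$ from $s$ if $\mathcal P_{\mathcal M,s,\sigma}(\varphi)=\mathrm{val}(s)$.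 $\mathsf F\mathsf G A$ is the set of runs all but finitely many of whose transitions are in $A$. $\mathcal M$ is universally transient if for every start state and every strategy, almost every run visits no state infinitely often. *)

(* Defs.v *)
From HB Require Import structures.
From mathcomp Require Import all_boot all_order all_algebra.
From mathcomp Require Import all_classical all_reals all_analysis.
From mathcomp Require Import lra.
Import Order.TTheory GRing.Theory Num.Theory.
Import numFieldNormedType.Exports.

Set Implicit Arguments.
Unset Strict Implicit.
Unset Printing Implicit Defensive.

Local Open Scope classical_set_scope.
Local Open Scope ring_scope.

Definition is_distr (R : realType) (S : countType) (p : S -> R) (D : set S) :=
  [/\ forall t, 0 <= p t, forall t, ~ D t -> p t = 0
    & \esum_(t in [set: S]) (p t)%:E = 1%E].

(* The random states are those outside [controlled]; the values of [prob] at
   controlled states are irrelevant. *)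
Record mdp (R : realType) (S : countType) := MDP {
  controlled : {pred S};
  step : rel S;
  prob : S -> S -> R;
  step_total : forall s, exists t, step s t;
  prob_distr : forall s, s \notin controlled ->
    is_distr (prob s) [set t | step s t] }.

Section MDP.
Variables (R : realType) (S : countType) (M : mdp R S).

Definition succs (s : S) : set S := [set t | step M s t].

Definition transitions : set (S * S) := [set e | step M e.1 e.2].

(* The edges of a run are determined by its states, so only the latter are
   recorded. *)
Record run (s : S) := Run {
  run_state :> nat -> S;
  run_start : run_state 0%N = s;
  run_step : forall i, step M (run_state i) (run_state i.+1) }.

Lemma default_run_proof s i :
  step M (iter i (fun t => xchoose (step_total M t)) s)
         (iter i.+1 (fun t => xchoose (step_total M t)) s).
Proof. exact: xchooseP (step_total M _). Qed.

Definition default_run s : run s := Run erefl (@default_run_proof s).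

HB.instance Definition _ s := gen_eqMixin (run s).
HB.instance Definition _ s := gen_choiceMixin (run s).
HB.instance Definition _ s := isPointed.Build (run s) (default_run s).

Definition cylinder s (w : seq S) : set (run s) :=
  [set r | mkseq r (size w) = w].

(* With [S] countable and discrete, this is the Borel sigma-algebra of the
   runs from [s]. *)
HB.instance Definition _ s :=
  Measurable.copy (run s) (g_sigma_algebraType (range (@cylinder s))).

(* [h] lists the states before the current state [s].  As every state has a
   successor, the finite prefixes of runs are the finite step-paths; see
   [historyP]. *)
Definition is_prefix (h : seq S) (s : S) : bool :=
  sorted (step M) (rcons h s).

Definition history (h : seq S) (s : S) : bool :=
  is_prefix h s && (s \in controlled M).

(* Only the values at histories matter. *)
Record strategy := Strategy {
  choice_of :> seq S -> S -> S -> R;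
  choice_distr : forall h s, history h s -> is_distr (choice_of h s) (succs s) }.

Definition deterministic (sigma : strategy) := forall h s, history h s ->
  exists t, forall u, sigma h s u = (u == t)%:R.

Definition memoryless (sigma : strategy) := forall h h' s,
  history h s -> history h' s -> sigma h s =1 sigma h' s.

(* The number of steps taken so far in the history [h, s] is [size h]. *)
Definition Markov (sigma : strategy) := forall h h' s,
  history h s -> history h' s -> size h = size h' -> sigma h s =1 sigma h' s.

Definition next_distr (sigma : strategy) (h : seq S) (s : S) : S -> R :=
  if s \in controlled M then sigma h s else prob M s.

Fixpoint path_prob (sigma : strategy) (h : seq S) (s : S) (w : seq S) : R :=
  if w is t :: w' then next_distr sigma h s t * path_prob sigma (rcons h s) t w'
  else 1.

Definition is_run_law (sigma : strategy) (s : S)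
    (mu : probability (run s) R) :=
  forall w, mu (cylinder (s :: w)) = (path_prob sigma [::] s w)%:E.

End MDP.

Lemma mkseq_cons (T : Type) (f : nat -> T) n :
  mkseq f n.+1 = f 0%N :: mkseq (fun i => f i.+1) n.
Proof. by rewrite /mkseq /= -[1%N]addn0 iotaDl -map_comp. Qed.

Lemma extend_path (R : realType) (S : countType) (M : mdp R S) (t : S)
    (w : seq S) : sorted (step M) (t :: w) ->
  exists r : run M t, mkseq r (size w).+1 = t :: w.
Proof.
elim: w t => [|u w IH] t.
  by exists (default_run M t); rewrite /mkseq /=.
move=> /= /andP[tu puw]; have [r rw] := IH _ puw.
pose f i := if i is j.+1 then r j else t.
have fS i : step M (f i) (f i.+1).
  by case: i => [|i] /=; [rewrite run_start | exact: run_step].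
exists (@Run _ _ M t f erefl fS).
by rewrite /= mkseq_cons -[in RHS]rw.
Qed.

Lemma historyP (R : realType) (S : countType) (M : mdp R S) (h : seq S)
    (s : S) :
  is_prefix M h s <->
  exists t (r : run M t), mkseq r (size h).+1 = rcons h s.
Proof.
split=> [hs|[t [r rw]]].
  case E : (rcons h s) => [|t w]; first by have := congr1 size E; rewrite size_rcons.
  have [|r rw] := @extend_path _ _ M t w; first by rewrite -E.
  by exists t, r; rewrite -rw; congr mkseq; have := congr1 size E;
    rewrite size_rcons.
rewrite /is_prefix -rw; apply/(sortedP t) => i; rewrite size_mkseq => ih.
by rewrite !nth_mkseq ?(ltnW ih) //; exact: run_step.
Qed.

(* [S] is enumerated through [pickle]. *)
Section cumulative.
Variables (R : realType) (S : countType) (p : S -> R) (D : set S).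
Hypothesis p_distr : is_distr p D.

Definition mass (k : nat) : R := if @pickle_inv S k is Some t then p t else 0.

Definition cumul (k : nat) : R := \sum_(i < k) mass i.

Lemma mass_ge0 k : 0 <= mass k.
Proof. by rewrite /mass; case: pickle_inv => // t; case: p_distr. Qed.

Lemma mass_pickle t : mass (pickle t) = p t.
Proof. by rewrite /mass pickleK_inv. Qed.

Lemma cumulS k : cumul k.+1 = cumul k + mass k.
Proof. by rewrite /cumul big_ord_recr. Qed.

Lemma cumul_ge0 k : 0 <= cumul k.
Proof. by apply: sumr_ge0 => i _; exact: mass_ge0. Qed.

Lemma cumul_homo : {homo cumul : i j / (i <= j)%N >-> i <= j}.
Proof.
apply: homo_leq => [x|y x z|k].
- exact: lexx.
- exact: le_trans.
- by rewrite cumulS lerDl; exact: mass_ge0.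
Qed.

Lemma mass_series : (\sum_(0 <= i <oo) (mass i)%:E = 1)%E.
Proof.
have m0 i : (0 <= (mass i)%:E)%E by rewrite lee_fin mass_ge0.
have [_ _ <-] := p_distr.
rewrite nneseries_esumT//.
transitivity (\esum_(i in pickle @` [set: S]) (mass i)%:E)%E; last first.
  rewrite (esum_image setT pickle); first by apply: eq_esum => t _; rewrite mass_pickle.
  by move=> x y _ _; exact: (pcan_inj (@pickleK S)).
rewrite [RHS]esum_mkcond; apply: eq_esum => i _; case: ifPn => //.
rewrite notin_setE => ni; rewrite /mass.
case E : (@pickle_inv S i) => [t|//]; case: ni; exists t => //.
by have := @pickle_invK S i; rewrite E.
Qed.

Lemma cumul_le1 k : cumul k <= 1.
Proof.
rewrite -lee_fin -mass_series /cumul -sumEFin -(big_mkord xpredT (fun i => (mass i)%:E)).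
by apply: nneseries_lim_ge => i _ _; rewrite lee_fin mass_ge0.
Qed.

Lemma cumul_gt u : u < 1 -> exists k, u < cumul k.
Proof.
move=> u1; apply/not_existsP => H.
suff : (1%:E <= u%:E)%E by rewrite lee_fin leNgt u1.
rewrite -[leLHS]mass_series; apply: lime_le.
  by apply: is_cvg_nneseries => i _ _; rewrite lee_fin mass_ge0.
apply: nearW => k; rewrite big_mkord sumEFin lee_fin leNgt; exact/negP/H.
Qed.

Definition quantile_spec (u : R) (t : S) :=
  cumul (pickle t) <= u < cumul (pickle t) + p t.

Lemma quantile_ex u : 0 <= u < 1 -> exists t, quantile_spec u t.
Proof.
move=> /andP[u0 u1]; have ex := cumul_gt u1.
case: (ex_minnP ex) => -[|k] kP kmin.
  by move: kP; rewrite /cumul big_ord0 ltNge u0.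
have ku : cumul k <= u by rewrite leNgt; apply/negP => /kmin; rewrite ltnn.
have : 0 < mass k by move: kP; rewrite cumulS; lra.
rewrite /mass; case E : (@pickle_inv S k) => [t|]; last by rewrite ltxx.
move=> _; exists t; have := @pickle_invK S k; rewrite E /= /quantile_spec => tk.
by rewrite tk ku /= -mass_pickle tk -cumulS.
Qed.

Lemma quantile_uniq u t t' : quantile_spec u t -> quantile_spec u t' -> t = t'.
Proof.
have H x y : quantile_spec u x -> quantile_spec u y -> ~ (pickle x < pickle y)%N.
  rewrite /quantile_spec => /andP[_ ux] /andP[uy _] /cumul_homo.
  by rewrite cumulS mass_pickle; lra.
move=> ht ht'; apply: (pcan_inj (@pickleK S)).
by apply/eqP; rewrite eqn_leq; apply/andP; split; rewrite leqNgt; apply/negP; exact: H.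
Qed.

End cumulative.

(* Existence of the run law: the states of a run are read off a point [u] of
   [0, 1[ under the Lebesgue measure.  At each step, [u] selects a successor by
   inversion of the cumulative distribution and is then rescaled to [0, 1[, so
   that the preimage of a cylinder is a subinterval of [0, 1[ whose length is
   the probability of the cylinder. *)
Section run_law_exists.
Variables (R : realType) (S : countType) (M : mdp R S) (sigma : strategy M).
Local Notation nd := (next_distr sigma).

Lemma next_distrP h s : is_prefix M h s -> is_distr (nd h s) (succs M s).
Proof.
move=> hs; rewrite /next_distr; case: ifPn => sc; last exact: prob_distr.
by apply: choice_distr; rewrite /history hs.
Qed.

Lemma is_prefix_rcons h s t :
  is_prefix M (rcons h s) t = is_prefix M h s && step M s t.
Proof.
by rewrite /is_prefix; case: h => [|x h] /=; rewrite ?andbT// !rcons_path last_rcons.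
Qed.

Lemma next_distr_step h s t : is_prefix M h s -> nd h s t != 0 ->
  is_prefix M (rcons h s) t.
Proof.
move=> hs; rewrite is_prefix_rcons hs /=; apply: contraR => /negP nst.
by have [_ -> //] := next_distrP hs.
Qed.

Definition offset h s (t : S) := cumul (nd h s) (pickle t).

Definition draw h s (u : R) : S := xget s (quantile_spec (nd h s) u).

Definition advance (x : seq S * S * R) : seq S * S * R :=
  let: (h, s, u) := x in
  let t := draw h s u in (rcons h s, t, (u - offset h s t) / nd h s t).

Lemma draw_spec h s u : is_prefix M h s -> 0 <= u < 1 ->
  quantile_spec (nd h s) u (draw h s u).
Proof.
move=> /next_distrP d u01; have [t ut] := quantile_ex d u01.
exact: (@xgetPex _ s (quantile_spec (nd h s) u) (ex_intro _ t ut)).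
Qed.

Definition good (x : seq S * S * R) := is_prefix M x.1.1 x.1.2 /\ 0 <= x.2 < 1.

Lemma advance_good x : good x -> good (advance x) /\ step M x.1.2 (advance x).1.2.
Proof.
case: x => -[h s] u [/= hs u01]; have /andP[] := draw_spec hs u01.
set t := draw h s u; rewrite -/(offset h s t) => h1 h2.
have q0 : 0 < nd h s t by lra.
have hst : is_prefix M (rcons h s) t by apply: next_distr_step => //; rewrite gt_eqF.
split; last by move: hst; rewrite is_prefix_rcons => /andP[].
split=> //=; rewrite divr_ge0 ?subr_ge0 ?(ltW q0)//=.
by rewrite ltr_pdivrMr// mul1r; lra.
Qed.

Lemma iter_advance_good x n : good x -> good (iter n advance x).
Proof. by move=> gx; elim: n => //= n /advance_good[]. Qed.

Definition traj x (n : nat) : S := (iter n advance x).1.2.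

Lemma trajP x n : good x -> step M (traj x n) (traj x n.+1).
Proof. by move=> /(iter_advance_good n)/advance_good[]. Qed.

Lemma path_prob_bound h s w : is_prefix M h s -> 0 <= path_prob sigma h s w.
Proof.
elim: w h s => //= t w IH h s hs.
have [d _ _] := next_distrP hs.
have [->|q0] := eqVneq (nd h s t) 0; first by rewrite mul0r.
by rewrite mulr_ge0 // IH // next_distr_step.
Qed.

Lemma traj_itv w h s : is_prefix M h s -> exists2 a : R,
  0 <= a /\ a + path_prob sigma h s w <= 1 &
  forall u : R, (0 <= u < 1 /\ mkseq (fun i => traj (h, s, u) i.+1) (size w) = w) <->
    a <= u < a + path_prob sigma h s w.
Proof.
elim: w h s => [|t w IH] h s hs /=.
  exists 0; first by split; lra.
  by move=> u; rewrite add0r; split=> [[]|].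
have d := next_distrP hs; have [d0 _ _] := d.
pose F := offset h s t; pose q := nd h s t.
have F0 : 0 <= F by exact: cumul_ge0 d _.
have Fq : F + q <= 1 by have := cumul_le1 d (pickle t).+1; rewrite cumulS mass_pickle.
have shift u : mkseq (fun i => traj (h, s, u) i.+1) (size w).+1 =
    draw h s u :: mkseq (fun i => traj (advance (h, s, u)) i.+1) (size w).
  rewrite mkseq_cons; congr cons.
  by apply: eq_mkseq => i; rewrite /traj iterSr.
have [q0|q0] := eqVneq q 0.
  exists 0; first by rewrite -/q q0 mul0r; split; lra.
  move=> u; rewrite -/q q0 mul0r shift; split; last by move=> uI; exfalso; lra.
  move=> [u01 [du _]]; have := draw_spec hs u01.
  by rewrite /quantile_spec du -/q q0; lra.
have {}q0 : 0 < q by rewrite lt_neqAle eq_sym q0 d0.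
have hst : is_prefix M (rcons h s) t by apply: next_distr_step => //; rewrite gt_eqF.
have [a [a0 a1] aP] := IH _ _ hst.
have pp := path_prob_bound w hst.
move: a1 aP pp; set p' := path_prob sigma (rcons h s) t w => a1 aP pp.
have qa0 : 0 <= q * a by rewrite mulr_ge0 // ltW.
have qap : q * a + q * p' <= q by rewrite -mulrDr -[leRHS]mulr1 ler_pM2l.
have qp0 : 0 <= q * p' by rewrite mulr_ge0 // ltW.
exists (F + q * a); first by rewrite -/q; split; lra.
move=> u; rewrite -/q shift.
have scale : (a <= (u - F) / q < a + p') = (F + q * a <= u < F + q * a + q * p').
  rewrite ler_pdivlMr // ltr_pdivrMr // mulrDl [a * q]mulrC [p' * q]mulrC.
  by congr andb; lra.
have drawE : quantile_spec (nd h s) u t -> 0 <= u < 1 -> draw h s u = t.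
  by move=> ut u01; apply: quantile_uniq d _ _ _ (draw_spec hs u01) ut.
split.
  move=> [u01 [du rest]]; rewrite -scale; apply/(aP _); split.
    have /advance_good[[_]] : good (h, s, u) by split.
    by rewrite /= du.
  by move: rest; rewrite /advance du.
move=> uI; have u01 : 0 <= u < 1 by lra.
have du : draw h s u = t.
  apply: drawE => //; rewrite /quantile_spec -/(offset h s t) -/F -/q; lra.
split=> //; congr cons => //; move: uI; rewrite -scale => /(aP _)[_].
by rewrite /advance du.
Qed.

Variable s0 : S.

Definition unit_run (u : R) : run M s0 :=
  if pselect (0 <= u < 1) is left u01 then
    @Run _ _ M s0 (traj ([::], s0, u)) erefl
      (fun i => @trajP ([::], s0, u) i (conj isT u01))
  else default_run M s0.

Lemma unit_run_cylinder w : exists a,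
  [/\ 0 <= path_prob sigma [::] s0 w
    & `[0, 1[%classic `&` unit_run @^-1` cylinder (s0 :: w) =
      `[a, a + path_prob sigma [::] s0 w[%classic].
Proof.
have hs : is_prefix M [::] s0 by [].
have [a _ aP] := traj_itv w hs.
exists a; split; first exact: path_prob_bound.
have cE u : 0 <= u < 1 -> cylinder (s0 :: w) (unit_run u) <->
    mkseq (fun i => traj ([::], s0, u) i.+1) (size w) = w.
  move=> u01; rewrite /cylinder /unit_run /=; case: pselect => // u01'.
  rewrite mkseq_cons.
  by split=> [[]|->].
apply/seteqP; split=> u /=; rewrite !in_itv /=.
  by move=> [u01 /(cE _ u01) uw]; apply/aP.
by move=> /aP[u01 uw]; split=> //; apply/cE.
Qed.

Lemma cylinder_neq (r : run M s0) w : cylinder w r ->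
  w = [::] \/ exists w', w = s0 :: w'.
Proof.
case: w => [|t w]; first by left.
by rewrite /cylinder /= => -[]; rewrite run_start => <- _; right; exists w.
Qed.

Lemma measurable_unit_run :
  measurable_fun (setT : set (measurableTypeR R)) unit_run.
Proof.
have mI : measurable (`[0, 1[%classic : set (measurableTypeR R)).
  exact: measurable_itv.
apply: (measurability (range (@cylinder _ _ M s0))) => //.
move=> _ [_ [w _ <-] <-]; rewrite setTI.
set X := _ @^-1` _.
suff mIX : measurable (`[0, 1[%classic `&` X : set (measurableTypeR R)).
  have [dX|ndX] := pselect (cylinder w (default_run M s0)).
    suff -> : X = (`[0, 1[%classic `&` X) `|` ~` `[0, 1[%classic.
      by apply: measurableU => //; exact: measurableC.
    apply/seteqP; split=> u /=; first by have [?|?] := pselect (`[0, 1[%classic u); [left|right].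
    case=> [[]//|]; rewrite in_itv /= /X /unit_run /= => u01.
    by case: pselect.
  suff -> : X = `[0, 1[%classic `&` X by [].
  apply/seteqP; split=> u /=; last by case.
  move=> Xu; split=> //; move: Xu; rewrite in_itv /= /X /unit_run /=.
  by case: pselect.
case: w @X => [|t w] X.
  suff -> : X = setT by rewrite setIT.
  by apply/seteqP; split.
have [ts|ts] := eqVneq t s0.
  have [a [_ E]] := unit_run_cylinder w.
  by rewrite /X ts E; exact: measurable_itv.
suff -> : X = set0 by rewrite setI0.
apply/seteqP; split=> u //; rewrite /X /cylinder /= mkseq_cons run_start => -[st _].
by move/eqP: ts; rewrite -st.
Qed.

Let mI : measurable (`[0, 1[%classic : set (measurableTypeR R)).
Proof. exact: measurable_itv. Qed.

Definition unit_law : set (run M s0) -> \bar R :=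
  fun X => mrestr lebesgue_measure mI (unit_run @^-1` X).

Let unit_law0 : unit_law set0 = 0%E.
Proof. by rewrite /unit_law preimage_set0 measure0. Qed.

Let unit_law_ge0 X : (0 <= unit_law X)%E.
Proof. exact: measure_ge0. Qed.

Let unit_law_additive : semi_sigma_additive unit_law.
Proof.
exact: (@measure_semi_sigma_additive _ _ _
  (measure_function_pushforward__canonical__measure_function_Measure
    (mrestr lebesgue_measure mI) measurable_unit_run)).
Qed.

HB.instance Definition _ := isMeasure.Build _ _ _ unit_law
  unit_law0 unit_law_ge0 unit_law_additive.

Let unit_lawT : unit_law setT = 1%E.
Proof.
rewrite /unit_law /mrestr preimage_setT setTI lebesgue_measure_itv /= lte_fin.
by rewrite ltr01 oppr0 adde0.
Qed.

HB.instance Definition _ := Measure_isProbability.Build _ _ _ unit_law unit_lawT.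

Lemma run_law_exists : exists mu : probability (run M s0) R, is_run_law sigma mu.
Proof.
exists unit_law => w; have [a [p0 E]] := unit_run_cylinder w.
rewrite /= /unit_law /mrestr setIC E lebesgue_measure_itv /= lte_fin.
rewrite ltrDl -EFinB addrC addKr; case: ltP => // pn.
by congr EFin; apply/eqP; rewrite eq_le p0 pn.
Qed.

Lemma run_law_unique (mu nu : probability (run M s0) R) :
  is_run_law sigma mu -> is_run_law sigma nu ->
  forall X, measurable X -> mu X = nu X.
Proof.
move=> muP nuP X mX.
have cyl0 : cylinder [::] = [set: run M s0] by apply/seteqP; split.
have cylS t w : t != s0 -> cylinder (t :: w) = set0 :> set (run M s0).
  move=> ts; apply/seteqP; split=> r //.
  rewrite /cylinder /= mkseq_cons run_start => -[st _].
  by move/eqP: ts; rewrite -st.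
apply: (measure_unique (range (@cylinder _ _ M s0)) (fun=> setT)) => //.
- have H w w' : (size w <= size w')%N ->
      range (@cylinder _ _ M s0) (cylinder w `&` cylinder w').
    move=> ww'; have [E|nE] := eqVneq (take (size w) w') w.
      exists w' => //; apply/seteqP; split=> r; last by case.
      rewrite /cylinder /= => rw'; split=> //.
      rewrite -[RHS]E -[in RHS]rw'.
      by rewrite /mkseq -map_take take_iota (minn_idPl ww').
    have e0 : cylinder w `&` cylinder w' = set0 :> set (run M s0).
      apply/seteqP; split=> r //; rewrite /cylinder /= => -[rw rw'].
      move: nE; rewrite -[in X in X != _]rw' -[X in _ != X]rw.
      by rewrite /mkseq -map_take take_iota (minn_idPl ww') eqxx.
    rewrite e0.
    have [t ts] : exists t, t != s0.
      apply/not_existsP => all; move/eqP: nE; apply.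
      have Hs t : t = s0 by apply/eqP; rewrite -[_ == _]negbK; apply/negP; exact: all.
      apply: (@eq_from_nth _ s0); first by rewrite size_takel.
      by move=> i _; rewrite [LHS]Hs [RHS]Hs.
    by exists [:: t] => //; rewrite cylS.
  move=> _ _ [w _ <-] [w' _ <-]; have [|/ltnW] := leqP (size w) (size w').
    exact: H.
  by rewrite setIC; exact: H.
- by move=> _; exists [::].
- by rewrite bigcup_const //; exists 0%N.
- move=> _ [[|t w] _ <-]; first by rewrite cyl0; exact: etrans (probability_setT mu) (esym (probability_setT nu)).
  have [->|ts] := eqVneq t s0; first exact: etrans (muP w) (esym (nuP w)).
  by rewrite cylS // !measure0.
- by move=> _; apply: (@le_lt_trans _ _ 1%E); [exact: probability_le1|exact: ltry].
Qed.

End run_law_exists.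

Section objectives.
Variables (R : realType) (S : countType) (M : mdp R S).

Definition run_law (sigma : strategy M) (s : S) : probability (run M s) R :=
  sval (cid (run_law_exists sigma s)).

Lemma run_lawP (sigma : strategy M) (s : S) :
  is_run_law sigma (run_law sigma s).
Proof. exact: svalP (cid (run_law_exists sigma s)). Qed.

Definition FG (s : S) (A : set (S * S)) : set (run M s) :=
  [set r | \forall i \near \oo, A (r i, r i.+1)].

Definition val_of (s : S) (phi : set (run M s)) : \bar R :=
  ereal_sup [set run_law sigma s phi | sigma in [set: strategy M]].

Definition optimal (s : S) (phi : set (run M s)) (sigma : strategy M) :=
  run_law sigma s phi = val_of phi.

Definition universally_transient := forall (s : S) (sigma : strategy M),
  {ae run_law sigma s,
    forall r : run M s, forall t : S, finite_set [set i | r i = t]}.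

End objectives.

Arguments FG {R S} M s A.

(* Main.v *)
(**
Write [phi] for the objective, which is invariant under shifts, and [value] for
its value.  A strategy that is optimal from a state stays optimal after every
step, so it only uses value-preserving moves between states from which the
value is attained; along such moves [value] is a martingale.

A restriction of the moves to some of the value-preserving ones that still
guarantees a fixed fraction of [value] at every state guarantees all of it up
to [e]: approximate [phi] by an event [C] decided by the first [n] steps, and
switch after [n] steps, off [C], to a strategy that secures this fraction.

Under universal transience, MD strategies are [e]-optimal.  Almost every run
that satisfies [phi] violates each [A i] only from finitely many states, which
makes [phi] a consequence of a safety objective that costs only [e].  For
safety it is enough to lose at most [zeta s * (1 - rho s)] at every visit of
[s], where [rho s < 1] bounds the probability of returning to [s] under all MD
strategies.

Enumerate the states.  At the [n]-th state, choose an MD strategy that is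
almost optimal from it within the moves left, and fix its choices wherever it
secures a third of the value.  By the previous remark nothing is lost, and the
chosen strategy stays in the fixed region with a large probability.  The MD
strategy obtained in the limit secures three quarters of [value] everywhere,
hence all of it.

The second part is the first one for the product with a step counter, which is
universally transient.
*)
Require Import Defs.
From mathcomp Require Import all_boot all_order all_algebra.
From mathcomp Require Import all_classical all_reals all_analysis.
From mathcomp Require Import lra.
Import Order.TTheory GRing.Theory Num.Theory.
Import numFieldNormedType.Exports.

Set Implicit Arguments.
Unset Strict Implicit.
Unset Printing Implicit Defensive.

Local Open Scope classical_set_scope.
Local Open Scope ring_scope.

(** * Averages over countable distributions *)

Section avg.
Variables (R : realType) (S : countType).
Implicit Types (p f g : S -> R).

(** Turns sums over [S] into series over [nat], for which linearity, sigma-additivity and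
    [epsilon_trick0] are stated. *)
Definition spread (a : S -> \bar R) (k : nat) : \bar R :=
  if @pickle_inv S k is Some t then a t else 0%E.

Lemma spread_ge0 (a : S -> \bar R) k : (forall t, 0 <= a t)%E ->
  (0 <= spread a k)%E.
Proof. by move=> a0; rewrite /spread; case: pickle_inv. Qed.

Lemma spread_pickle (a : S -> \bar R) t : spread a (pickle t) = a t.
Proof. by rewrite /spread pickleK_inv. Qed.

Lemma esum_spread (a : S -> \bar R) : (forall t, 0 <= a t)%E ->
  \esum_(t in [set: S]) a t = (\sum_(0 <= k <oo) spread a k)%E.
Proof.
move=> a0; have s0 k := spread_ge0 k a0.
rewrite nneseries_esumT//.
transitivity (\esum_(k in pickle @` [set: S]) spread a k)%E.
  rewrite (esum_image setT pickle).
    by apply: eq_esum => t _; rewrite spread_pickle.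
  by move=> x y _ _; exact: (pcan_inj (@pickleK S)).
rewrite [LHS]esum_mkcond; apply: eq_esum => k _; case: ifPn => //.
rewrite notin_setE => nk; rewrite /spread.
case E : (@pickle_inv S k) => [t|//]; case: nk; exists t => //.
by have := @pickle_invK S k; rewrite E.
Qed.

Lemma esumZl (r : R) (a : S -> \bar R) : 0 <= r -> (forall t, 0 <= a t)%E ->
  (\esum_(t in [set: S]) (r%:E * a t) = r%:E * \esum_(t in [set: S]) a t)%E.
Proof.
move=> r0 a0; rewrite !esum_spread// => [|t]; last by rewrite mule_ge0.
rewrite -nneseriesZl => [|k _]; last exact: spread_ge0.
by apply: eq_eseriesr => k _; rewrite /spread; case: pickle_inv => //; rewrite mule0.
Qed.

Lemma esum_exchange (T : countType) (a : S -> T -> \bar R) :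
  (forall s t, 0 <= a s t)%E ->
  (\esum_(s in [set: S]) \esum_(t in [set: T]) a s t =
   \esum_(t in [set: T]) \esum_(s in [set: S]) a s t)%E.
Proof.
move=> a0; rewrite (@esum_esum R S T setT (fun=> setT))//.
rewrite (@esum_esum R T S setT (fun=> setT) (fun t s => a s t))//.
rewrite (reindex_esum ([set: T] `*`` fun=> [set: S]) _ (fun x => (x.2, x.1)))//.
split=> //=; first by move=> [i j] [j' i'] _ _ [-> ->].
by move=> [i j] _ /=; exists (j, i).
Qed.

(** Finite mass rather than mass one: [avg] is also taken against the loss weights [zeta] in
    [safe_md]. *)
Definition weights p :=
  (forall t, 0 <= p t) /\ (\esum_(t in [set: S]) (p t)%:E < +oo)%E.

Definition bounded0 f := exists B, forall t, 0 <= f t <= B.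

Definition avg p f : R := fine (\esum_(t in [set: S]) (p t * f t)%:E)%E.

Lemma distr_weights p D : is_distr p D -> weights p.
Proof. by case=> p0 _ p1; split=> //; rewrite p1 ltry. Qed.

Lemma bounded0D f g : bounded0 f -> bounded0 g ->
  bounded0 (fun t => f t + g t).
Proof.
move=> [B fB] [C gC]; exists (B + C) => t; have := fB t; have := gC t.
by move=> ? ?; lra.
Qed.

Lemma bounded0Z c f : 0 <= c -> bounded0 f -> bounded0 (fun t => c * f t).
Proof.
move=> c0 [B fB]; exists (c * B) => t; have /andP[f0 ff] := fB t.
by rewrite mulr_ge0//= ler_wpM2l.
Qed.

Lemma bounded0_cst c : 0 <= c -> bounded0 (fun=> c).
Proof. by move=> c0; exists c => t; rewrite c0 lexx. Qed.

Lemma avgE p f : weights p -> bounded0 f ->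
  ((avg p f)%:E = \esum_(t in [set: S]) (p t * f t)%:E)%E.
Proof.
move=> [p0 ps] [B fB]; rewrite /avg fineK//.
have pf0 t : (0 <= (p t * f t)%:E)%E.
  by rewrite lee_fin mulr_ge0//; case/andP: (fB t).
rewrite ge0_fin_numE; last by apply: esum_ge0 => t _.
(* On an empty [S] the bound [B] may be negative, so this case is treated apart. *)
have [t0|noS] := pselect (exists t0 : S, True); last first.
  by rewrite esum1 ?ltry// => t; case: noS; exists t.
have B0 : 0 <= B by case: t0 => t0 _; case/andP: (fB t0); exact: le_trans.
apply: (@le_lt_trans _ _ (\esum_(t in [set: S]) (B%:E * (p t)%:E))%E).
  apply: le_esum => t _; rewrite -EFinM lee_fin mulrC ler_wpM2r//.
  by case/andP: (fB t).
rewrite esumZl//.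
by rewrite lte_mul_pinfty// lee_fin.
Qed.

Lemma avg_ge0 p f : weights p -> bounded0 f -> 0 <= avg p f.
Proof.
move=> pw fb; rewrite -lee_fin avgE//; apply: esum_ge0 => t _.
by rewrite lee_fin; case: pw fb => p0 _ [B fB]; rewrite mulr_ge0//; case/andP: (fB t).
Qed.

Lemma le_avg p f g : weights p -> bounded0 f -> bounded0 g ->
  (forall t, p t != 0 -> f t <= g t) -> avg p f <= avg p g.
Proof.
move=> pw fb gb fg; rewrite -lee_fin !avgE//; apply: le_esum => t _.
rewrite lee_fin; have [->|pt] := eqVneq (p t) 0; first by rewrite !mul0r.
by rewrite ler_wpM2l ?fg//; case: pw.
Qed.

Lemma eq_avg p q f g : (forall t, p t = q t) ->
  (forall t, p t != 0 -> f t = g t) -> avg p f = avg q g.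
Proof.
move=> pq fg; congr fine; apply: eq_esum => t _.
rewrite -pq; have [->|pt] := eqVneq (p t) 0; first by rewrite !mul0r.
by rewrite fg.
Qed.

Lemma avgD p f g : weights p -> bounded0 f -> bounded0 g ->
  avg p (fun t => f t + g t) = avg p f + avg p g.
Proof.
move=> pw fb gb; apply: EFin_inj; rewrite EFinD !avgE//; last exact: bounded0D.
rewrite -esumD; first by apply: eq_esum => t _; rewrite -EFinD mulrDr.
- by case: pw fb => p0 _ [B fB] t _; rewrite lee_fin mulr_ge0//; case/andP: (fB t).
- by case: pw gb => p0 _ [B fB] t _; rewrite lee_fin mulr_ge0//; case/andP: (fB t).
Qed.

Lemma avgZ p c f : 0 <= c -> weights p -> bounded0 f ->
  avg p (fun t => c * f t) = c * avg p f.
Proof.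
move=> c0 pw fb; apply: EFin_inj; rewrite EFinM !avgE//; last exact: bounded0Z.
rewrite -esumZl//; first by apply: eq_esum => t _; rewrite -EFinM mulrCA.
by case: pw fb => p0 _ [B fB] t; rewrite lee_fin mulr_ge0//; case/andP: (fB t).
Qed.

Lemma avg_cst p D c : is_distr p D -> 0 <= c -> avg p (fun=> c) = c.
Proof.
move=> pd c0; have pw := distr_weights pd.
have H : avg p (fun=> 1) = 1.
  apply: EFin_inj; rewrite avgE//; last exact: bounded0_cst.
  by case: pd => _ _ <-; apply: eq_esum => t _; rewrite mulr1.
have -> : avg p (fun=> c) = avg p (fun=> c * 1).
  by apply: eq_avg => // t _; rewrite mulr1.
by rewrite avgZ// ?H ?mulr1//; exact: bounded0_cst.
Qed.

Lemma avg_ge_term p f t : weights p -> bounded0 f -> p t * f t <= avg p f.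
Proof.
move=> pw fb; rewrite -lee_fin avgE//.
have pf0 t' : (0 <= (p t' * f t')%:E)%E.
  by case: pw fb => p0 _ [B fB]; rewrite lee_fin mulr_ge0//; case/andP: (fB t').
rewrite -(esum_set1 (a := fun t => (p t * f t)%:E) (pf0 t)).
rewrite [leLHS]esum_mkcond; apply: le_esum => t' _; case: ifP => // _; exact: pf0.
Qed.

(** The slack [g - f] is nonnegative on the support and has average at most zero, so each of its
    terms vanishes. This turns optimality at a state into equalities at its successors. *)
Lemma avg_eq_le p f g : weights p -> bounded0 f -> bounded0 g ->
  (forall t, p t != 0 -> f t <= g t) -> avg p g <= avg p f ->
  forall t, p t != 0 -> f t = g t.
Proof.
move=> pw fb gb fg gf t pt.
(* Outside the support nothing is known about the sign of [g - f], hence the cut to zero. *)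
pose h t := if p t == 0 then 0 else g t - f t.
have hb : bounded0 h.
  case: gb => C gC; exists C => u; rewrite /h; case: eqVneq => [_|pu].
    by rewrite lexx /=; case/andP: (gC u); exact: le_trans.
  have := fg u pu; have := gC u; case: (fb) => B fB; have := fB u; lra.
have E : avg p g = avg p f + avg p h.
  by rewrite -avgD//; apply: eq_avg => // u pu; rewrite /h (negPf pu) addrC subrK.
have pt0 : 0 < p t by rewrite lt_neqAle eq_sym pt; have [-> _] := pw.
have := avg_ge_term t pw hb; rewrite /h (negPf pt) => H.
have : p t * (g t - f t) <= 0 by lra.
rewrite pmulr_rle0//; have := fg t pt; lra.
Qed.

Lemma avg_dirac p f t : bounded0 f -> (forall u, p u = (u == t)%:R) ->
  avg p f = f t.
Proof.
move=> [B fB] pE; rewrite /avg (_ : esum _ _ = (f t)%:E)//.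
have -> : (f t)%:E = (\esum_(u in [set t]) (f u)%:E)%E.
  by rewrite esum_set1// lee_fin; case/andP: (fB t).
rewrite [RHS]esum_mkcond.
apply: eq_esum => u _; rewrite pE.
have -> : (u \in [set t]) = (u == t) by apply/idP/eqP; rewrite inE.
by case: eqP => _ /=; rewrite ?mul1r ?mul0r.
Qed.

End avg.

Lemma avg_exchange (R : realType) (S T : countType) (p : S -> R) (q : T -> R)
    (F : T -> S -> R) B :
  weights p -> weights q -> (forall t s, 0 <= F t s <= B) ->
  avg p (fun s => avg q (F^~ s)) = avg q (fun t => avg p (F t)).
Proof.
move=> pw qw FB.
have Fs t : bounded0 (F t) by exists B.
have Ft s : bounded0 (F^~ s) by exists B.
rewrite {1}/avg [RHS]/avg; congr fine.
have [p0 _] := pw; have [q0 _] := qw.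
have F0 t s : 0 <= F t s by case/andP: (FB t s).
transitivity (\esum_(s in [set: S]) \esum_(t in [set: T])
    ((p s)%:E * (q t * F t s)%:E))%E.
  apply: eq_esum => s _; rewrite EFinM avgE// esumZl// => t.
  by rewrite lee_fin mulr_ge0.
rewrite esum_exchange; last by move=> s t; rewrite -EFinM lee_fin !mulr_ge0.
apply: eq_esum => t _; rewrite EFinM avgE// -esumZl//.
  by apply: eq_esum => s _; rewrite -!EFinM mulrCA.
by move=> s; rewrite lee_fin mulr_ge0.
Qed.

(** * Run laws and residual strategies *)

Definition scons (T : Type) (x : T) (f : nat -> T) : nat -> T :=
  fun n => if n is m.+1 then f m else x.

(* [C f] is decided by [f 0], ..., [f n]. *)
Definition determined (T : Type) (n : nat) (C : set (nat -> T)) :=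
  forall f g, (forall i, (i <= n)%N -> f i = g i) -> C f -> C g.

Section events.
Variables (R : realType) (S : countType) (M : mdp R S).

Definition event (s : S) (E : set (nat -> S)) : set (run M s) :=
  [set r | E r].
Arguments event s E : clear implicits.

Definition measurable_event (E : set (nat -> S)) :=
  forall s, measurable (event s E).

Lemma measurable_cylinder s w : measurable (@cylinder R S M s w).
Proof. by apply: sub_sigma_algebra; exists w. Qed.

Lemma measurable_event_determined n C : determined n C -> measurable_event C.
Proof.
move=> Cn s.
have -> : event s C = \bigcup_(w in [set w | size w = n.+1 /\
    exists2 f, mkseq f n.+1 = w & C f]) @cylinder R S M s w.
  apply/seteqP; split=> r.
    move=> Cr; exists (mkseq r n.+1); last by rewrite /cylinder /mkset size_mkseq.
    by split; [rewrite size_mkseq | exists r].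
  case=> w /= [sw [f fw Cf]]; rewrite /cylinder /= sw -fw => fr.
  apply: Cn Cf => i ni.
  by have := congr1 (nth s ^~ i) fr; rewrite /= !nth_mkseq.
rewrite bigcup_mkcond; apply: countable_bigcupT_measurable; first exact: countableP.
by move=> w; case: ifP => _ //; exact: measurable_cylinder.
Qed.

Lemma measurable_eventI E F : measurable_event E -> measurable_event F ->
  measurable_event (E `&` F).
Proof. by move=> mE mF s; exact: measurableI (mE s) (mF s). Qed.

Lemma measurable_eventD E F : measurable_event E -> measurable_event F ->
  measurable_event (E `\` F).
Proof. by move=> mE mF s; exact: measurableD (mE s) (mF s). Qed.

Lemma measurable_event_bigcup (F : nat -> set (nat -> S)) :
  (forall i, measurable_event (F i)) -> measurable_event (\bigcup_i F i).
Proof.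
move=> mF s; rewrite (_ : event _ _ = \bigcup_i event s (F i)).
  by apply: bigcupT_measurable => i; exact: mF.
by apply/seteqP; split=> r [i _ Fr]; exists i.
Qed.

Lemma measurable_event_bigcap (F : nat -> set (nat -> S)) :
  (forall i, measurable_event (F i)) -> measurable_event (\bigcap_i F i).
Proof.
move=> mF s; rewrite (_ : event _ _ = \bigcap_i event s (F i)).
  by apply: bigcapT_measurable => i; exact: mF.
by apply/seteqP; split=> r Fr i; exact: Fr.
Qed.

Lemma cylinder_nil s : cylinder [::] = [set: run M s].
Proof. by apply/seteqP; split. Qed.

Lemma cylinder_start s : cylinder [:: s] = [set: run M s].
Proof. by apply/seteqP; split=> // r _; rewrite /cylinder /mkset mkseq_cons run_start. Qed.

Lemma cylinder_other s t w : t != s -> cylinder (t :: w) = set0 :> set (run M s).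
Proof.
move=> ts; apply/seteqP; split=> r //.
rewrite /cylinder /= mkseq_cons run_start => -[st _].
by move/eqP: ts; rewrite -st.
Qed.

Lemma cylinderI s w w' : (size w <= size w')%N ->
  cylinder w `&` cylinder w' =
  (if take (size w) w' == w then cylinder w' else set0) :> set (run M s).
Proof.
move=> ww'.
have tk (r : run M s) : cylinder w' r -> mkseq r (size w) = take (size w) w'.
  move=> rw; rewrite -[in RHS]rw /mkseq -map_take take_iota.
  by rewrite (minn_idPl ww').
case: eqP => E; apply/seteqP; split=> r //=.
- by case.
- by move=> rw'; split=> //; rewrite /cylinder /= (tk r).
- by case=> rw rw'; apply: E; rewrite -(tk r).
Qed.

(** The cylinders through [s] and the empty set are closed under intersection and generate the
    sigma-algebra. Finite measures are allowed, since run laws are later restricted to a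
    cylinder. *)
Lemma finite_measure_unique s (mu nu : {measure set (run M s) -> \bar R}) :
  (mu setT < +oo)%E -> (forall w, mu (cylinder (s :: w)) = nu (cylinder (s :: w))) ->
  forall X, measurable X -> mu X = nu X.
Proof.
move=> muoo munu X mX.
pose G : set (set (run M s)) := [set C | C = set0 \/ exists w, C = cylinder (s :: w)].
have GT : G setT by right; exists [::]; rewrite cylinder_start.
have Gm : G `<=` measurable.
  by move=> _ [->|[w ->]] //; exact: measurable_cylinder.
have GI : setI_closed G.
  move=> C C' [->|[w ->]] GC'; first by rewrite set0I; left.
  have H v v' : (size v <= size v')%N ->
      G (cylinder (s :: v) `&` cylinder (s :: v')).
    by move=> vv'; rewrite cylinderI//; case: ifP => _; [right; exists v'|left].
  case: GC' => [->|[w' ->]]; first by rewrite setI0; left.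
  have [|/ltnW] := leqP (size w) (size w'); first exact: H.
  by rewrite setIC; exact: H.
apply: (g_sigma_algebra_measure_unique G Gm (fun=> setT)) => //.
- by rewrite bigcup_const//; exists 0%N.
- by move=> _ [->|[w ->]]; rewrite ?measure0.
move: X mX; apply: smallest_sub => [|_ [w _ <-]]; first exact: smallest_sigma_algebra.
case: w => [|t w]; first by rewrite cylinder_nil; exact: sub_sigma_algebra.
apply: sub_sigma_algebra; have [->|ts] := eqVneq t s; first by right; exists w.
by left; rewrite cylinder_other.
Qed.

Lemma measurable_into_run d (T : measurableType d) s (F : T -> run M s) :
  (forall w, measurable (F @^-1` cylinder (s :: w))) -> measurable_fun setT F.
Proof.
move=> mF; apply: (measurability (range (@cylinder R S M s))) => //.
move=> _ [_ [w _ <-] <-]; rewrite setTI; case: w => [|t w].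
  by rewrite cylinder_nil preimage_setT.
have [->//|ts] := eqVneq t s.
by rewrite cylinder_other// preimage_set0.
Qed.

Lemma run_cons_proof s u (su : step M s u) (r : run M u) i :
  step M (scons s r i) (scons s r i.+1).
Proof. by case: i => [|i] /=; [rewrite run_start | exact: run_step]. Qed.

Definition run_cons s u (su : step M s u) (r : run M u) : run M s :=
  @Run R S M s (scons s r) erefl (run_cons_proof su r).

Lemma preimage_run_cons s u (su : step M s u) w :
  run_cons su @^-1` cylinder (s :: w) = cylinder w.
Proof.
apply/seteqP; split=> r; rewrite /cylinder /= mkseq_cons; first by case.
by move=> E; congr cons.
Qed.

Lemma measurable_run_cons s u (su : step M s u) :
  measurable_fun setT (run_cons su).
Proof.
apply: measurable_into_run => w; rewrite preimage_run_cons.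
exact: measurable_cylinder.
Qed.

End events.

Arguments event {R S} M s E.

(** * Residual strategies and the law of a run after its first step *)

Section residual.
Variables (R : realType) (S : countType) (M : mdp R S).
Implicit Types (sigma : strategy M) (s t u : S).

Lemma residual_proof sigma s h t : history M h t ->
  is_distr (if history M (s :: h) t then sigma (s :: h) t else sigma h t)
    (succs M t).
Proof. by move=> ht; case: ifPn => [sht|_]; exact: choice_distr. Qed.

(* The strategy that remains after a first step from [s]; the second branch
   only makes it a distribution at histories that cannot follow [s]. *)
Definition residual sigma s : strategy M := Strategy (residual_proof sigma s).

Lemma next_residual sigma s h t : is_prefix M (s :: h) t ->
  next_distr (residual sigma s) h t =1 next_distr sigma (s :: h) t.
Proof.
move=> sht u; rewrite /next_distr /=; case: ifPn => tc //.
by rewrite /history sht tc.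
Qed.

Lemma path_prob_residual sigma s h u w : is_prefix M (s :: h) u ->
  path_prob (residual sigma s) h u w = path_prob sigma (s :: h) u w.
Proof.
elim: w h u => //= t w IH h u shu; rewrite next_residual//.
have [->|nz] := eqVneq (next_distr sigma (s :: h) u t) 0; first by rewrite !mul0r.
by rewrite IH // -rcons_cons; exact: next_distr_step nz.
Qed.

Lemma next_distr1 sigma s : is_distr (next_distr sigma [::] s) (succs M s).
Proof. exact: next_distrP. Qed.

Lemma next_weights sigma s : weights (next_distr sigma [::] s).
Proof. exact: distr_weights (next_distr1 sigma s). Qed.

Lemma next_step sigma s u : next_distr sigma [::] s u != 0 -> step M s u.
Proof.
have [_ H _] := next_distr1 sigma s.
by apply: contraR => /negP nst; rewrite H.
Qed.

Lemma run_law_le1 sigma s (X : set (run M s)) : measurable X ->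
  (run_law sigma s X <= 1)%E.
Proof. exact: probability_le1. Qed.

Lemma run_law_cons sigma s u (X : set (run M s)) : measurable X ->
  forall su : step M s u,
  run_law sigma s (X `&` cylinder [:: s; u]) =
  ((next_distr sigma [::] s u)%:E *
   run_law (residual sigma s) u (run_cons su @^-1` X))%E.
Proof.
move=> mX su; have q0 : 0 <= next_distr sigma [::] s u.
  by have [] := next_distr1 sigma s.
pose mu : {measure set (run M s) -> \bar R} :=
  mrestr (run_law sigma s) (@measurable_cylinder R S M s [:: s; u]).
pose nu : {measure set (run M s) -> \bar R} := mscale (NngNum q0)
  (measure_function_pushforward__canonical__measure_function_Measure
    (run_law (residual sigma s) u) (measurable_run_cons su)).
apply: (@finite_measure_unique R S M s mu nu) => //.
  rewrite /mu /= /mrestr (@le_lt_trans _ _ 1%E) ?ltry// run_law_le1//.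
  by rewrite setTI; exact: measurable_cylinder.
move=> w; rewrite /mu /nu /= /mrestr /mscale /= /pushforward.
case: w => [|t w].
  rewrite cylinder_start preimage_setT setTI probability_setT mule1.
  by rewrite (run_lawP sigma s [:: u]) /= mulr1.
rewrite setIC cylinderI//= take0.
rewrite preimage_run_cons.
have [<-|tu] := eqVneq u t; last first.
  rewrite (@cylinder_other _ _ _ u t) 1?eq_sym// measure0 mule0.
  by case: eqP => [[ut]|_]; [rewrite ut eqxx in tu | rewrite measure0].
rewrite eqxx (run_lawP sigma s (u :: w)) (run_lawP (residual sigma s) u w) /=.
by rewrite EFinM path_prob_residual//= /is_prefix /= su.
Qed.

End residual.

(** * Real-valued probabilities of events on state sequences *)

Section pr.
Variables (R : realType) (S : countType) (M : mdp R S).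
Implicit Types (sigma tau : strategy M) (s t u : S) (E F : set (nat -> S)).

(* The value at non-measurable events is junk, but keeps [pr] below [1]. *)
Definition pr sigma s E : R :=
  if `[< measurable (event M s E) >] then fine (run_law sigma s (event M s E))
  else 0.

Lemma prE sigma s E : measurable (event M s E) ->
  (pr sigma s E)%:E = run_law sigma s (event M s E).
Proof.
move=> mE; rewrite /pr asboolT// fineK// ge0_fin_numE//.
by rewrite (@le_lt_trans _ _ 1%E) ?ltry// run_law_le1.
Qed.

Lemma pr_ge0 sigma s E : 0 <= pr sigma s E.
Proof. by rewrite /pr; case: ifP => // _; exact: fine_ge0. Qed.

Lemma pr_le1 sigma s E : pr sigma s E <= 1.
Proof.
have [mE|nmE] := pselect (measurable (event M s E)).
  by rewrite -lee_fin prE// run_law_le1.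
by rewrite /pr asboolF.
Qed.

Lemma bounded0_pr (sigma : S -> strategy M) (E : S -> set (nat -> S)) :
  bounded0 (fun u => pr (sigma u) u (E u)).
Proof. by exists 1 => u; rewrite pr_ge0 pr_le1. Qed.

Lemma le_pr sigma s E F : measurable_event M E -> measurable_event M F ->
  E `<=` F -> pr sigma s E <= pr sigma s F.
Proof.
move=> mE mF EF; rewrite -lee_fin !prE//.
by apply: le_measure; rewrite ?inE// => r; exact: EF.
Qed.

Lemma pr_sure sigma s E : (forall r : run M s, E r) -> pr sigma s E = 1.
Proof.
move=> Es; have ET : event M s E = setT by apply/seteqP; split=> // r _; exact: Es.
by apply: EFin_inj; rewrite prE ET// probability_setT.
Qed.

Lemma pr_split sigma s E F : measurable_event M E -> measurable_event M F ->
  pr sigma s E = pr sigma s (E `&` F) + pr sigma s (E `\` F).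
Proof.
move=> mE mF; apply: EFin_inj; rewrite EFinD !prE//.
- have -> : event M s E = event M s (E `&` F) `|` event M s (E `\` F).
    apply/seteqP; split=> r; last by case=> -[].
    by move=> Er; have [Fr|nFr] := pselect (F r); [left|right].
  rewrite measureU//; [exact: measurable_eventI|exact: measurable_eventD|].
  by apply/seteqP; split=> r // -[[_ Fr] [_]].
- exact: measurable_eventD.
- exact: measurable_eventI.
Qed.

Lemma pr_bigcup s (F : nat -> set (nat -> S)) e :
  (forall i, measurable_event M (F i)) -> (forall i, F i `<=` F i.+1) -> 0 < e ->
  forall sigma, exists k, pr sigma s (\bigcup_i F i) < pr sigma s (F k) + e.
Proof.
move=> mF Fi e0 sigma.
have cv : run_law sigma s \o (fun i => event M s (F i)) @ \oo -->
    run_law sigma s (\bigcup_i event M s (F i)).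
  apply: nondecreasing_cvg_mu.
  - by move=> i; exact: mF.
  - by apply: bigcupT_measurable => i; exact: mF.
  - apply/nondecreasing_seqP => i; apply/subsetPset => r; exact: Fi.
have E : event M s (\bigcup_i F i) = \bigcup_i event M s (F i).
  by apply/seteqP; split=> r [i _ Fr]; exists i.
apply/not_existsP => H.
have le k : (run_law sigma s (event M s (F k)) <=
    (pr sigma s (\bigcup_i F i) - e)%:E)%E.
  by rewrite -prE; [rewrite lee_fin lerBrDr leNgt; exact/negP/H|exact: mF].
have := cvg_lim _ cv => /(_ (@ereal_hausdorff R)) lE.
have : (lim (run_law sigma s \o (fun i => event M s (F i)) @ \oo) <=
    (pr sigma s (\bigcup_i F i) - e)%:E)%E.
  apply: lime_le; first by apply/cvg_ex; eexists; exact: cv.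
  exact: nearW.
rewrite lE -E -prE; last exact: measurable_event_bigcup.
by rewrite lee_fin; lra.
Qed.

(** Continuity from above, obtained from [pr_bigcup] by complements. *)
Lemma pr_bigcap sigma s (F : nat -> set (nat -> S)) x :
  (forall i, measurable_event M (F i)) -> (forall i, F i.+1 `<=` F i) ->
  (forall i, x <= pr sigma s (F i)) -> x <= pr sigma s (\bigcap_i F i).
Proof.
move=> mF Fi xF.
have mI := measurable_event_bigcap mF.
pose G i := setT `\` F i.
have mT : measurable_event M setT by move=> t; exact: measurableT.
have mG i : measurable_event M (G i) by exact: measurable_eventD.
have FG i : pr sigma s (G i) = 1 - pr sigma s (F i).
  by rewrite -(@pr_sure sigma s setT)// (pr_split sigma s mT (mF i)) setTI addrC addKr.
have IG : pr sigma s (\bigcup_i G i) = 1 - pr sigma s (\bigcap_i F i).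
  rewrite -(@pr_sure sigma s setT)// (pr_split sigma s mT mI) setTI addrC addKr.
  by congr pr; rewrite /G setTD setC_bigcap; apply: eq_bigcupr => i _; rewrite setTD.
rewrite leNgt; apply/negP => xI.
have Gi i : G i `<=` G i.+1 by move=> f [_ nF]; split=> // /Fi.
have e0 : 0 < x - pr sigma s (\bigcap_i F i) by rewrite subr_gt0.
by have [k] := pr_bigcup s mG Gi e0 sigma; rewrite IG FG; have := xF k; lra.
Qed.

Lemma measurable_tail sigma s u E : measurable (event M s E) ->
  step M s u -> measurable (event M u [set f | E (scons s f)]).
Proof.
move=> mE su; have := measurable_run_cons su measurableT mE.
by rewrite setTI; congr measurable; apply/seteqP; split.
Qed.

(** The runs split according to their state after one step, and [run_law_cons] evaluates each piece.
    This equation carries most of the inductions below. *)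
Lemma pr_step sigma s E : measurable_event M E ->
  pr sigma s E = avg (next_distr sigma [::] s)
    (fun u => pr (residual sigma s) u [set f | E (scons s f)]).
Proof.
move=> mE; apply: EFin_inj; rewrite avgE; first last.
- exact: bounded0_pr.
- exact: next_weights.
rewrite prE//; set q := next_distr _ _ _.
transitivity (\esum_(u in [set: S])
    run_law sigma s (event M s E `&` cylinder [:: s; u]))%E; last first.
  apply: eq_esum => u _; have [q0|nz] := eqVneq (q u) 0.
    rewrite q0 mul0r; apply/eqP; rewrite -measure_le0.
    apply: (@le_trans _ _ (run_law sigma s (cylinder [:: s; u]))).
      by apply: le_measure; rewrite ?inE//; [apply: measurableI => //|];
        exact: measurable_cylinder.
    by rewrite run_lawP /= -/q q0 mul0r.
  have su : step M s u := next_step nz.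
  rewrite (run_law_cons sigma (mE s) su) EFinM prE//.
  exact: measurable_tail (mE s) su.
rewrite esum_spread//.
pose F k : set (run M s) := if @pickle_inv S k is Some u
  then event M s E `&` cylinder [:: s; u] else set0.
have mF k : measurable (F k).
  rewrite /F; case: pickle_inv => [u|] //.
  by apply: measurableI => //; exact: measurable_cylinder.
have EF : event M s E = \bigcup_k F k.
  apply/seteqP; split=> r.
    move=> Er; exists (pickle (r 1%N)) => //; rewrite /F pickleK_inv; split=> //.
    by rewrite /cylinder /mkset !mkseq_cons run_start.
  by case=> k _; rewrite /F; case: pickle_inv => // u [].
rewrite [in LHS]EF measure_semi_bigcup//; last exact: bigcupT_measurable.
- apply: eq_eseriesr => k _; rewrite /F /spread.
  by case: (@pickle_inv S k) => [u|]; rewrite ?measure0.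
- apply/trivIsetP => i j _ _ ij; apply/seteqP; split=> r //; rewrite /F.
  case Ei : (@pickle_inv S i) => [u|]; last by case.
  case Ej : (@pickle_inv S j) => [u'|]; last by case.
  rewrite /cylinder /= => -[[_ ru] [_ ru']]; move/eqP: ij; apply.
  have := @pickle_invK S i; rewrite Ei /= => <-.
  have := @pickle_invK S j; rewrite Ej /= => <-.
  by move: ru'; rewrite ru => -[->].
Qed.

(** [head t h] is the first state of the prefix [h], [t]: only prefixes of runs from [s] influence
    the law from [s]. *)
Definition agree sigma tau s := forall h t, is_prefix M h t -> head t h = s ->
  next_distr sigma h t =1 next_distr tau h t.

Lemma agree_path_prob sigma tau s h t w : agree sigma tau s ->
  is_prefix M h t -> head t h = s ->
  path_prob sigma h t w = path_prob tau h t w.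
Proof.
move=> ag; elim: w h t => //= u w IH h t ht hs.
rewrite ag//; have [->|nz] := eqVneq (next_distr tau h t u) 0; first by rewrite !mul0r.
rewrite IH//; first exact: next_distr_step nz.
by case: h hs {ht nz}.
Qed.

Lemma eq_law_pr sigma tau s :
  (forall w, path_prob sigma [::] s w = path_prob tau [::] s w) ->
  forall E, pr sigma s E = pr tau s E.
Proof.
move=> st E; rewrite /pr; case: ifP => // /asboolP mE; congr fine.
apply: (run_law_unique (sigma := sigma)) => //; first exact: run_lawP.
by move=> w; rewrite run_lawP st.
Qed.

Lemma agree_pr sigma tau s E : agree sigma tau s -> pr sigma s E = pr tau s E.
Proof.
by move=> ag; apply: eq_law_pr => w; exact: agree_path_prob ag _ _.
Qed.

End pr.

(** * Coupling of strategies that agree as long as the run stays in a set *)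

Section coupling.
Variables (R : realType) (S : countType) (M : mdp R S).
Implicit Types (sigma tau : strategy M) (s t : S) (T : set S).

(** Realises the laws of all strategies on one probability space, the unit interval, so that runs of
    two strategies can be compared seed by seed. *)
Lemma run_law_unit sigma s X : measurable X ->
  run_law sigma s X = lebesgue_measure
    (@unit_run R S M sigma s @^-1` X `&` (`[0, 1[%classic : set (measurableTypeR R))).
Proof.
move=> mX.
have mI : measurable (`[0, 1[%classic : set (measurableTypeR R)).
  exact: measurable_itv.
pose nu : {measure set (run M s) -> \bar R} :=
  measure_function_pushforward__canonical__measure_function_Measure
    (mrestr lebesgue_measure mI) (@measurable_unit_run R S M sigma s).
apply: (@finite_measure_unique R S M s (run_law sigma s) nu) => //.
  by rewrite (@le_lt_trans _ _ 1%E) ?ltry// run_law_le1.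
move=> w; rewrite /nu /= /pushforward /mrestr run_lawP setIC.
have [a [p0 ->]] := @unit_run_cylinder R S M sigma s w.
rewrite lebesgue_measure_itv /= lte_fin ltrDl -EFinB addrC addKr.
case: ltP => // pn.
by congr EFin; apply/eqP; rewrite eq_le p0 pn.
Qed.

Lemma iter_advance_history sigma x n : x.1.1 = [::] ->
  (iter n (advance sigma) x).1.1 = mkseq (traj sigma x) n.
Proof.
move=> x0; elim: n => //= n IH; rewrite mkseqS -IH /traj.
by case: (iter n _ x) => -[].
Qed.

Definition stay T : set (nat -> S) := [set f | forall n, T (f n)].

Definition agree_within T sigma tau s := forall h t, is_prefix M h t ->
  head t h = s -> (forall x, x \in rcons h t -> T x) ->
  next_distr sigma h t = next_distr tau h t.

(** Started from the same seed [u], the two trajectories see the same next-state distribution, hence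
    make the same draw, at each step of a trajectory inside [T]. *)
Lemma iter_advance_agree T sigma tau s u n : agree_within T sigma tau s ->
  0 <= u < 1 -> (forall i, T (traj sigma ([::], s, u) i)) ->
  iter n (advance sigma) ([::], s, u) = iter n (advance tau) ([::], s, u).
Proof.
move=> ag u01 Tt; elim: n => //= n <-.
have := @iter_advance_good R S M sigma ([::], s, u) n (conj isT u01).
have := @iter_advance_history sigma ([::], s, u) n erefl.
have : (iter n (advance sigma) ([::], s, u)).1.2 = traj sigma ([::], s, u) n by [].
case: (iter n _ _) => -[h t] v /= tE hE [/= ht v01].
have {tE}hE : rcons h t = mkseq (traj sigma ([::], s, u)) n.+1.
  by rewrite mkseqS hE tE.
have E : next_distr sigma h t = next_distr tau h t.
  apply: ag => //.
    have : head t (rcons h t) = s by rewrite hE mkseq_cons.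
    by case: (h).
  by rewrite hE => x /mapP[i _ ->].
by rewrite /draw /offset E.
Qed.

Lemma unit_run_agree T sigma tau s E u : agree_within T sigma tau s ->
  0 <= u < 1 -> (E `&` stay T) (unit_run sigma s u) ->
  (E `&` stay T) (unit_run tau s u).
Proof.
move=> ag u01; rewrite /unit_run; case: pselect => // u01' ET.
suff tt : traj sigma ([::], s, u) = traj tau ([::], s, u) by move: ET; rewrite /= tt.
apply/funext => n; rewrite /traj (iter_advance_agree n ag)//.
by case: ET.
Qed.

Lemma agree_within_sym T sigma tau s :
  agree_within T sigma tau s -> agree_within T tau sigma s.
Proof. by move=> ag h t *; rewrite ag. Qed.

Lemma measurable_stay T : measurable_event M (stay T).
Proof.
rewrite (_ : stay T = \bigcap_n [set f | T (f n)]).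
  apply: measurable_event_bigcap => n; apply: (@measurable_event_determined _ _ _ n).
  by move=> f g fg /=; rewrite fg.
by apply/seteqP; split=> f Tf n; [move=> _; exact: Tf|exact: Tf].
Qed.

(** The seeds whose run satisfies [E] and never leaves [T] are the same for both strategies. *)
Lemma agree_within_pr T sigma tau s E : agree_within T sigma tau s ->
  measurable_event M E ->
  pr sigma s (E `&` stay T) = pr tau s (E `&` stay T).
Proof.
move=> ag mE.
have mET : measurable (event M s (E `&` stay T)).
  exact: measurable_eventI mE (measurable_stay T) s.
apply: EFin_inj; rewrite !prE// !run_law_unit//; congr lebesgue_measure.
apply/seteqP; split=> u /= [Eu]; rewrite in_itv /= => u01; split=> //.
  exact: unit_run_agree ag u01 Eu.
exact: unit_run_agree (agree_within_sym ag) u01 Eu.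
Qed.

End coupling.

(** * Switching strategies, restricted moves and memoryless strategies *)

Section strategies.
Variables (R : realType) (S : countType) (M : mdp R S).
Implicit Types (sigma tau : strategy M) (s t u : S) (E : set (nat -> S)).
Implicit Types (c : S -> S -> Prop).

Lemma is_prefix_cons s h t :
  is_prefix M (s :: h) t = step M s (head t h) && is_prefix M h t.
Proof. by rewrite /is_prefix; case: h. Qed.

Lemma residual_agree sigma tau s u : step M s u ->
  (forall h t, is_prefix M h t -> head t h = u ->
    next_distr sigma (s :: h) t =1 next_distr tau h t) ->
  agree (residual sigma s) tau u.
Proof.
move=> su ag h t ht hu x; rewrite next_residual ?ag//.
by rewrite is_prefix_cons hu su.
Qed.

Lemma agree_residual sigma tau s u : step M s u -> agree sigma tau s ->
  agree (residual sigma s) (residual tau s) u.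
Proof.
move=> su ag; apply: residual_agree => // h t ht hu x.
have sht : is_prefix M (s :: h) t by rewrite is_prefix_cons hu su.
by rewrite next_residual// ag.
Qed.

Lemma agree_sym sigma tau s : agree sigma tau s -> agree tau sigma s.
Proof. by move=> ag h t ht hs x; rewrite ag. Qed.

(** In a history [_ :: h'], [t] the state [head t h'] is the one reached by the first move; from
    there on the start is forgotten and the [rho] of that state is played. *)
Lemma switch_proof sigma (rho : S -> strategy M) h t : history M h t ->
  is_distr (if h is _ :: h' then rho (head t h') h' t else sigma h t)
    (succs M t).
Proof.
case: h => [|x h] ht; apply: choice_distr => //.
by move: ht; rewrite /history is_prefix_cons -andbA => /and3P[_ -> ->].
Qed.

Definition switch sigma rho : strategy M := Strategy (@switch_proof sigma rho).

Lemma next_switch sigma rho s :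
  next_distr (switch sigma rho) [::] s = next_distr sigma [::] s.
Proof. by []. Qed.

Lemma residual_switch sigma rho s u : step M s u ->
  agree (residual (switch sigma rho) s) (rho u) u.
Proof.
move=> su; apply: residual_agree => // h t _ <- x.
by rewrite /next_distr /=.
Qed.

Lemma pr_switch sigma rho s E : measurable_event M E ->
  pr (switch sigma rho) s E = avg (next_distr sigma [::] s)
    (fun u => pr (rho u) u [set f | E (scons s f)]).
Proof.
move=> mE; rewrite pr_step//; apply: eq_avg => // u nz.
by apply: agree_pr; apply: residual_switch; exact: next_step nz.
Qed.

Lemma dirac_distr t (D : set S) : D t ->
  is_distr (fun u => (u == t)%:R : R) D.
Proof.
move=> Dt; split=> [u|u Du|]; first exact: ler0n.
  by case: eqP => // ut; rewrite ut in Du.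
rewrite -(esum_set1 (a := fun=> 1%E) (t := t))// [RHS]esum_mkcond.
apply: eq_esum => u _; have -> : (u \in [set t]) = (u == t).
  by apply/idP/eqP; rewrite inE.
by case: eqP.
Qed.

Definition pure (pol : seq S -> S -> S) (polP : forall h s, step M s (pol h s))
  : strategy M := Strategy (fun h s _ => dirac_distr (polP h s)).

Lemma next_pure pol (polP : forall h s, step M s (pol h s)) h s u :
  s \in controlled M -> next_distr (pure polP) h s u = (u == pol h s)%:R.
Proof. by move=> sc; rewrite /next_distr sc. Qed.

(** [c] restricts the moves of positive probability, at random states too. [follows] is a greatest
    fixed point given by its finite approximations; [follows_coind] recovers coinduction. *)
Fixpoint follows_upto c n sigma s : Prop :=
  if n is m.+1 then forall u, next_distr sigma [::] s u != 0 ->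
    c s u /\ follows_upto c m (residual sigma s) u
  else True.

Definition follows c sigma s := forall n, follows_upto c n sigma s.

Lemma follows_step c sigma s u : follows c sigma s ->
  next_distr sigma [::] s u != 0 -> c s u /\ follows c (residual sigma s) u.
Proof.
move=> fs nz; split; first by have /(_ _ nz)[] := fs 1%N.
by move=> n; have /(_ _ nz)[] := fs n.+1.
Qed.

Lemma follows_coind c (P : strategy M -> S -> Prop) :
  (forall sigma s, P sigma s -> forall u, next_distr sigma [::] s u != 0 ->
    c s u /\ P (residual sigma s) u) ->
  forall sigma s, P sigma s -> follows c sigma s.
Proof.
move=> HP sigma s Ps n; elim: n sigma s Ps => //= n IH sigma s Ps u nz.
by have [cu Pu] := HP _ _ Ps u nz; split=> //; exact: IH.
Qed.

Lemma follows_intro c sigma s : (forall u, next_distr sigma [::] s u != 0 ->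
    c s u /\ follows c (residual sigma s) u) -> follows c sigma s.
Proof.
by move=> H [|n]//= u /H[cu fu]; split=> //; exact: fu.
Qed.

Lemma follows_mono c c' sigma s : (forall s u, c s u -> c' s u) ->
  follows c sigma s -> follows c' sigma s.
Proof.
move=> cc'; apply: follows_coind => {}sigma {}s fs u nz.
by have [cu fu] := follows_step fs nz; split=> //; exact: cc'.
Qed.

Lemma follows_agree c sigma tau s : agree sigma tau s ->
  follows c sigma s -> follows c tau s.
Proof.
move=> ag fs n; elim: n sigma tau s ag fs => //= n IH sigma tau s ag fs u nz.
have su := next_step nz; rewrite -(ag [::] s)// in nz.
have [cu fu] := follows_step fs nz; split=> //.
by apply: IH fu; exact: agree_residual.
Qed.

Lemma follows_switch c sigma rho s : follows c sigma s ->
  (forall u, next_distr sigma [::] s u != 0 -> follows c (rho u) u) ->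
  follows c (switch sigma rho) s.
Proof.
move=> fs fr; apply: follows_intro => u; rewrite next_switch => nz.
have [cu _] := follows_step fs nz; split=> //.
apply: follows_agree (fr u nz); apply: agree_sym; apply: residual_switch.
exact: next_step nz.
Qed.

Lemma distr_support (p : S -> R) D : is_distr p D -> exists u, p u != 0.
Proof.
case=> _ _ p1; apply/not_existsP => H; move: p1; rewrite esum1 => [[/eqP]|t _].
  by rewrite eq_sym oner_eq0.
by apply/eqP; rewrite eqe -[_ == _]negbK; exact/negP/H.
Qed.

Lemma distr_point (p : S -> R) D t : is_distr p D ->
  (forall u, p u != 0 -> u = t) -> forall u, p u = (u == t)%:R.
Proof.
move=> pd pt; have p0 u : u != t -> p u = 0.
  by move=> /eqP ut; apply/eqP; rewrite -[_ == _]negbK; apply/negP => /pt.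
have [pp _ p1] := pd.
have {}p1 : p t = 1.
  apply: EFin_inj; transitivity (\esum_(u in [set t]) (p u)%:E)%E.
    by rewrite esum_set1// lee_fin.
  rewrite -p1 [LHS]esum_mkcond; apply: eq_esum => u _ /=.
  case: ifPn => //; rewrite notin_setE => /= /eqP ut.
  by rewrite p0.
by move=> u; case: eqVneq => [->//|/p0].
Qed.

(** Where [c] leaves a single move, both strategies must take it with probability one; at random
    states both use [prob M]. Hence all path probabilities coincide. *)
Lemma follows_det_pr c sigma tau s E :
  (forall s u u', s \in controlled M -> c s u -> c s u' -> u = u') ->
  follows c sigma s -> follows c tau s -> pr sigma s E = pr tau s E.
Proof.
move=> cd fs ft; apply: eq_law_pr => w.
elim: w sigma tau s fs ft => //= u w IH sigma tau s fs ft.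
have E1 : next_distr sigma [::] s u = next_distr tau [::] s u.
  have [sc|sc] := boolP (s \in controlled M); last first.
    by rewrite /next_distr (negPf sc).
  have [x nzx] := distr_support (next_distr1 sigma s).
  have [cx _] := follows_step fs nzx.
  rewrite !(@distr_point _ _ x (next_distr1 _ s))// => y nzy.
    by have [cy _] := follows_step ft nzy; exact: cd cy cx.
  by have [cy _] := follows_step fs nzy; exact: cd cy cx.
rewrite E1; have [->|nz] := eqVneq (next_distr tau [::] s u) 0; first by rewrite !mul0r.
have su := next_step nz; congr (_ * _).
have p1 : is_prefix M [:: s] u by rewrite /is_prefix /= su.
rewrite -!path_prob_residual//; apply: IH.
  by have [] := follows_step fs (_ : next_distr sigma [::] s u != 0); rewrite ?E1.
by have [] := follows_step ft nz.
Qed.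

Section memoryless.
Variables (f : S -> S) (fP : forall s, step M s (f s)).

Definition md : strategy M := pure (fun _ => fP).

Lemma residual_md s u : step M s u -> agree (residual md s) md u.
Proof. by move=> su; apply: residual_agree. Qed.

Lemma pr_md_step s E : measurable_event M E ->
  pr md s E = avg (next_distr md [::] s)
    (fun u => pr md u [set g | E (scons s g)]).
Proof.
move=> mE; rewrite pr_step//; apply: eq_avg => // u nz.
by apply: agree_pr; apply: residual_md; exact: next_step nz.
Qed.

End memoryless.

End strategies.
(** * Values and optimal strategies *)

Section approximation.
Variables (R : realType) (S : countType) (M : mdp R S).
Implicit Types (sigma : strategy M) (s : S) (E F C : set (nat -> S)).

Lemma measurable_eventT : measurable_event M setT.
Proof. by move=> s; exact: measurableT. Qed.

Lemma pr_set0 sigma s : pr sigma s set0 = 0.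
Proof. by apply: EFin_inj; rewrite prE; [exact: measure0|exact: measurable0]. Qed.

Lemma prC sigma s E : measurable_event M E -> pr sigma s (~` E) = 1 - pr sigma s E.
Proof.
move=> mE; rewrite -(@pr_sure _ _ _ sigma s setT)//.
by rewrite (pr_split sigma s measurable_eventT mE) setTI setTD addrC addKr.
Qed.

Lemma measurable_eventC E : measurable_event M E -> measurable_event M (~` E).
Proof. by move=> mE; rewrite -setTD; exact: measurable_eventD measurable_eventT mE. Qed.

Lemma pr_subadd sigma s E F G : measurable_event M E -> measurable_event M F ->
  measurable_event M G -> E `<=` F `|` G ->
  pr sigma s E <= pr sigma s F + pr sigma s G.
Proof.
move=> mE mF mG EFG; rewrite (pr_split sigma s mE mF) lerD//.
  by apply: le_pr => //; exact: measurable_eventI.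
apply: le_pr => //; first exact: measurable_eventD.
by move=> f [/EFG[]].
Qed.

Definition approximable sigma s E := measurable_event M E /\
  forall e, 0 < e -> exists n C, [/\ determined n C,
    pr sigma s (E `\` C) <= e & pr sigma s (C `\` E) <= e].

Lemma approximable_determined sigma s n C : determined n C ->
  approximable sigma s C.
Proof.
move=> Cn; split; first exact: measurable_event_determined Cn.
by move=> e e0; exists n, C; split=> //; rewrite setDv pr_set0 ltW.
Qed.

Lemma determinedC n C : determined n C -> determined n (~` C).
Proof.
move=> Cn f g fg nCf Cg; apply: nCf; apply: Cn Cg => i ni.
by rewrite fg.
Qed.

Lemma approximableC sigma s E : approximable sigma s E ->
  approximable sigma s (~` E).
Proof.
move=> [mE aE]; split; first exact: measurable_eventC.
move=> e /aE[n [C [Cn EC CE]]]; exists n, (~` C); split.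
- exact: determinedC.
- by rewrite setDE setCK setIC -setDE.
- by rewrite setDE setCK setIC -setDE.
Qed.

(** Half of the error replaces the union by one [F k], the other half approximates [F k]. *)
Lemma approximable_bigcup sigma s (F : nat -> set (nat -> S)) :
  (forall i, approximable sigma s (F i)) -> (forall i, F i `<=` F i.+1) ->
  approximable sigma s (\bigcup_i F i).
Proof.
move=> aF Fi; have mF i : measurable_event M (F i) by have [] := aF i.
have mU := measurable_event_bigcup mF.
split=> // e e0; have e20 : 0 < e / 2 by rewrite divr_gt0.
have [k kF] := pr_bigcup s mF Fi e20 sigma.
have [_ /(_ _ e20)[n [C [Cn FC CF]]]] := aF k.
have mC := @measurable_event_determined R S M n C Cn.
exists n, C; split=> //.
  have : pr sigma s ((\bigcup_i F i) `\` C) <=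
      pr sigma s ((\bigcup_i F i) `\` F k) + pr sigma s (F k `\` C).
    apply: pr_subadd; try exact: measurable_eventD.
    by move=> f [Uf nCf]; have [Ff|nFf] := pselect (F k f); [right|left].
  have := pr_split sigma s mU (mF k).
  rewrite (_ : (\bigcup_i F i) `&` F k = F k); first by lra.
  by apply/seteqP; split=> f; [case|move=> Ff; split=> //; exists k].
apply: (@le_trans _ _ (pr sigma s (C `\` F k))); last by lra.
apply: le_pr; try exact: measurable_eventD.
by move=> f [Cf nU]; split=> // Ff; apply: nU; exists k.
Qed.

Lemma approximable_bigcap sigma s (F : nat -> set (nat -> S)) :
  (forall i, approximable sigma s (F i)) -> (forall i, F i.+1 `<=` F i) ->
  approximable sigma s (\bigcap_i F i).
Proof.
move=> aF Fi; rewrite -[\bigcap_i _]setCK setC_bigcap; apply: approximableC.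
apply: approximable_bigcup => i; first exact: approximableC.
exact: subsetC.
Qed.

End approximation.

(** * The value of a shift-invariant event and the moves that preserve it *)

Section value.
Variables (R : realType) (S : countType) (M : mdp R S) (phi : set (nat -> S)).
Implicit Types (sigma tau : strategy M) (s t u : S) (c : S -> S -> Prop).
Hypothesis phi_tail : forall s f, phi (scons s f) <-> phi f.
Hypothesis phi_approx : forall sigma s, approximable sigma s phi.

Definition default_strategy : strategy M :=
  pure (fun _ s => xchooseP (step_total M s)).

Lemma measurable_phi : measurable_event M phi.
Proof. by move=> s; have [mphi _] := phi_approx default_strategy s; exact: mphi. Qed.
Hint Resolve measurable_phi : core.

Lemma tail_phi s : [set f | phi (scons s f)] = phi.
Proof. by apply/seteqP; split=> f /=; rewrite phi_tail. Qed.

Lemma pr_phi_step sigma s : pr sigma s phi = avg (next_distr sigma [::] s)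
  (fun u => pr (residual sigma s) u phi).
Proof. by rewrite pr_step// tail_phi. Qed.

Lemma pr_switch_phi sigma rho s : pr (switch sigma rho) s phi =
  avg (next_distr sigma [::] s) (fun u => pr (rho u) u phi).
Proof. by rewrite pr_switch// tail_phi. Qed.

Definition value s : R := sup [set pr sigma s phi | sigma in [set: strategy M]].

Lemma value_has_sup s : has_sup [set pr sigma s phi | sigma in [set: strategy M]].
Proof.
split; first by exists (pr default_strategy s phi), default_strategy.
by exists 1 => _ [sigma _ <-]; exact: pr_le1.
Qed.

Lemma pr_le_value sigma s : pr sigma s phi <= value s.
Proof. by apply: ub_le_sup; [case: (value_has_sup s)|exists sigma]. Qed.

Lemma value_near s e : 0 < e -> exists sigma, value s - e < pr sigma s phi.
Proof.
by move=> /sup_adherent/(_ (value_has_sup s))[_ [sigma _ <-] H]; exists sigma.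
Qed.

Lemma value_ge0 s : 0 <= value s.
Proof. exact: le_trans (pr_ge0 _ _ _) (pr_le_value default_strategy s). Qed.

Lemma value_le1 s : value s <= 1.
Proof.
apply: ge_sup; first by case: (value_has_sup s).
by move=> _ [sigma _ <-]; exact: pr_le1.
Qed.

Lemma bounded0_value : bounded0 value.
Proof. by exists 1 => s; rewrite value_ge0 value_le1. Qed.

(** After the first move, nearly optimal strategies from all successors are combined by [switch]
    into one strategy from [s]. *)
Lemma avg_value_le sigma s : avg (next_distr sigma [::] s) value <= value s.
Proof.
apply/ler_addgt0Pr => e e0.
have [rho rhoP] := choice (fun u => value_near u e0).
have pb := bounded0_pr rho (fun=> phi); have eb := @bounded0_cst R S e (ltW e0).
have qw := next_weights sigma s.
apply: (@le_trans _ _ (avg (next_distr sigma [::] s) (fun u => pr (rho u) u phi + e))).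
  apply: le_avg => //; [exact: bounded0_value|exact: bounded0D|].
  by move=> u _; have := rhoP u; lra.
rewrite avgD// (avg_cst (next_distr1 _ _) (ltW e0)) lerD2r -pr_switch_phi.
exact: pr_le_value.
Qed.

Lemma value_controlled s u : s \in controlled M -> step M s u ->
  value u <= value s.
Proof.
move=> sc su.
pose pol (h : seq S) x := if x == s then u else xchoose (step_total M x).
have polP h x : step M x (pol h x).
  by rewrite /pol; case: eqP => [->//|_]; exact: xchooseP.
have := avg_value_le (pure polP) s.
rewrite (avg_dirac (t := u)); [by []|exact: bounded0_value|].
by move=> x; rewrite next_pure// /pol eqxx.
Qed.

Definition optimal_from sigma s := pr sigma s phi = value s.

Definition attained s := exists sigma, optimal_from sigma s.

Lemma optimal_avg_value sigma s : optimal_from sigma s ->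
  avg (next_distr sigma [::] s) value = value s.
Proof.
move=> os; apply/eqP; rewrite eq_le avg_value_le -{1}os pr_phi_step /=.
apply: le_avg; [exact: next_weights|exact: bounded0_pr|exact: bounded0_value|].
by move=> u _; exact: pr_le_value.
Qed.

(** The residual probabilities lie below the values but have the same average, so [avg_eq_le] makes
    them equal on the support. *)
Lemma optimal_residual sigma s u : optimal_from sigma s ->
  next_distr sigma [::] s u != 0 -> optimal_from (residual sigma s) u.
Proof.
move=> os; apply: (avg_eq_le (f := fun v => pr (residual sigma s) v phi)
  (g := value) (next_weights sigma s)).
- exact: bounded0_pr.
- exact: bounded0_value.
- by move=> v _; exact: pr_le_value.
- by rewrite -pr_phi_step optimal_avg_value// os.
Qed.

Lemma optimal_controlled sigma s u : optimal_from sigma s ->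
  s \in controlled M -> next_distr sigma [::] s u != 0 -> value u = value s.
Proof.
move=> os sc; apply: (avg_eq_le (f := value) (g := fun=> value s) (next_weights sigma s)).
- exact: bounded0_value.
- by apply: bounded0_cst; exact: value_ge0.
- by move=> v nz; apply: value_controlled => //; exact: next_step nz.
- by rewrite (avg_cst (next_distr1 _ _)) ?value_ge0// optimal_avg_value.
Qed.

(** Values are compared at controlled states only: at random states they are preserved just on
    average. *)
Definition preserving s u := [/\ attained s, attained u &
  s \in controlled M -> value u = value s].

Lemma optimal_follows sigma s : optimal_from sigma s ->
  follows preserving sigma s.
Proof.
apply: (follows_coind (P := optimal_from)) => {}sigma {}s os u nz.
have ou := optimal_residual os nz; split=> //; split.
- by exists sigma.
- by exists (residual sigma s).
- by move=> sc; exact: optimal_controlled os sc nz.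
Qed.

(** The martingale property of [value]. At a random state every strategy makes the same step, so the
    average can be computed with an optimal one. *)
Lemma preserving_avg_value sigma s : attained s -> follows preserving sigma s ->
  avg (next_distr sigma [::] s) value = value s.
Proof.
move=> [tau ot] fs; have [sc|sc] := boolP (s \in controlled M).
  rewrite -[RHS](avg_cst (next_distr1 sigma s) (value_ge0 s)).
  apply: eq_avg => // u nz.
  by have [[_ _ /(_ sc)]] := follows_step fs nz.
by rewrite -[RHS](optimal_avg_value ot) /next_distr (negPf sc).
Qed.

(** * From a fixed fraction of the value to all of it *)

Section boost.
Variable c : S -> S -> Prop.
Hypothesis c_preserving : forall s u, c s u -> preserving s u.
Hypothesis c_good : forall s, attained s ->
  exists sigma, follows c sigma s /\ value s <= 4 * pr sigma s phi.

(** [tau] copies [sigma] until [C] is decided, keeps to it on [C], and off [C] changes to a strategy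
    from [c_good]. Since [value] is a martingale bounded by one, its expectation off [C] at that
    time is at least [value s - pr sigma s C], and a quarter of it is secured. *)
Lemma boost_determined n C : determined n C -> forall sigma s, attained s ->
  follows c sigma s -> exists tau, follows c tau s /\
    4 * pr sigma s (phi `&` C) + (value s - pr sigma s C) <= 4 * pr tau s phi.
Proof.
elim: n C => [|n IH] C Cn sigma s sW fs.
  (* An event decided by the start alone can be tested on the constant sequence. *)
  have [Cs|nCs] := pselect (C (fun=> s)).
    have Cr (r : run M s) : C r by apply: Cn Cs => -[|//] _; rewrite run_start.
    exists sigma; split=> //; rewrite (pr_sure sigma Cr).
    have : pr sigma s (phi `&` C) <= pr sigma s phi.
      by apply: le_pr => //; apply: measurable_eventI => //; exact: measurable_event_determined Cn.
    by have := value_le1 s; lra.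
  have [tau [ft vt]] := c_good sW; exists tau; split=> //.
  have C0 (r : run M s) : ~ C r by move=> Cr; apply: nCs; apply: Cn Cr => -[|//] _; rewrite run_start.
  have mC := @measurable_event_determined R S M _ _ Cn.
  have : pr sigma s (~` C) = 1 by exact: pr_sure.
  rewrite prC// => pC.
  have : pr sigma s (phi `&` C) <= pr sigma s C.
    by apply: le_pr => //; exact: measurable_eventI.
  by have := pr_ge0 sigma s (phi `&` C); lra.
have mC := @measurable_event_determined R S M _ _ Cn.
pose Cs := [set f | C (scons s f)].
have Csn : determined n Cs.
  by move=> f g fg; apply: Cn => -[//|i] /= ni; exact: fg.
have mphiC : measurable_event M (phi `&` C) by exact: measurable_eventI.
have /choice[rho rhoP] : forall u, exists tau,
    next_distr sigma [::] s u != 0 -> follows c tau u /\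
    4 * pr (residual sigma s) u (phi `&` Cs) +
      (value u - pr (residual sigma s) u Cs) <= 4 * pr tau u phi.
  move=> u; have [z|nz] := eqVneq (next_distr sigma [::] s u) 0.
    by exists sigma.
  have [cu fu] := follows_step fs nz.
  have uW : attained u by have [] := c_preserving cu.
  by have [tau tauP] := IH _ Csn _ _ uW fu; exists tau.
exists (switch sigma rho); split.
  by apply: follows_switch => // u nz; have [] := rhoP u nz.
have qw := next_weights sigma s.
rewrite pr_switch_phi (pr_step sigma s mphiC) (pr_step sigma s mC).
have -> : [set f | (phi `&` C) (scons s f)] = phi `&` Cs.
  by rewrite -[in RHS](tail_phi s).
have fc : follows preserving sigma s by exact: follows_mono fs.
rewrite -(preserving_avg_value sW fc) -/Cs.
(* The subtracted probability is moved across, because the rules for [avg] concern nonnegative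
   functions. *)
suff : avg (next_distr sigma [::] s) (fun u =>
    4 * pr (residual sigma s) u (phi `&` Cs) + value u) <=
    avg (next_distr sigma [::] s) (fun u =>
    4 * pr (rho u) u phi + pr (residual sigma s) u Cs).
  have b1 := bounded0_pr (fun=> residual sigma s) (fun=> phi `&` Cs).
  have b2 := bounded0_pr (fun=> residual sigma s) (fun=> Cs).
  have b3 := bounded0_pr rho (fun=> phi).
  have bv := bounded0_value.
  by rewrite !avgD ?avgZ//; [lra|exact: bounded0Z|exact: bounded0Z].
apply: le_avg => //.
- by apply: bounded0D; [apply: bounded0Z => //; exact: bounded0_pr|exact: bounded0_value].
- by apply: bounded0D; [apply: bounded0Z => //; exact: bounded0_pr|exact: bounded0_pr].
- by move=> u nz; have [_] := rhoP u nz; lra.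
Qed.

(** If the supremum over the strategies following [c] were below [value s], then [boost_determined],
    applied to a nearly best [sigma] and to some [C] close to [phi], would exceed this supremum. *)
Lemma boost s e : attained s -> 0 < e ->
  exists sigma, follows c sigma s /\ value s - e <= pr sigma s phi.
Proof.
move=> sW e0; pose X := [set pr sigma s phi | sigma in [set sigma : strategy M | follows c sigma s]].
have supX : has_sup X.
  split; first by have [sigma [fs _]] := c_good sW; exists (pr sigma s phi), sigma.
  by exists 1 => _ [sigma _ <-]; exact: pr_le1.
suff : value s <= sup X.
  move=> vX; have [_ [sigma fs <-] H] := sup_adherent e0 supX.
  by exists sigma; split=> //; lra.
rewrite leNgt; apply/negP => Xv.
(* Of the twenty parts of the gap, the near-optimality of [sigma] and the two halves of the
   approximation error cost at most nine. *)
have d0 : 0 < (value s - sup X) / 20 by lra.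
have [_ [sigma fs <-] H] := sup_adherent d0 supX.
have sX : pr sigma s phi <= sup X by apply: ub_le_sup; [case: supX|exists sigma].
have [_ /(_ _ d0)[n [C [Cn phC Cph]]]] := phi_approx sigma s.
have mC := @measurable_event_determined R S M _ _ Cn.
have [tau [ft tauP]] := boost_determined Cn sW fs.
have tX : pr tau s phi <= sup X by apply: ub_le_sup; [case: supX|exists tau].
have := pr_split sigma s measurable_phi mC.
have := pr_split sigma s mC measurable_phi.
rewrite [C `&` phi]setIC.
lra.
Qed.

End boost.

End value.
(** * Safety objectives under universal transience *)

Lemma finite_nat_bound (A : set nat) : finite_set A ->
  exists n, forall i, A i -> (i < n)%N.
Proof.
move=> /finite_seqP[l ->]; exists (\max_(i <- l) i).+1 => i /= il.
by rewrite ltnS; exact: leq_bigmax_seq.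
Qed.

Section hitting.
Variables (R : realType) (S : countType) (M : mdp R S).
Implicit Types (sigma : strategy M) (s t : S) (E F : set (nat -> S)).

Lemma eq_pr sigma s E F : (forall r : run M s, E r <-> F r) ->
  pr sigma s E = pr sigma s F.
Proof.
move=> EF; rewrite /pr (_ : event M s E = event M s F)//.
by apply/seteqP; split=> r /EF.
Qed.

Definition hits t n : set (nat -> S) := [set f | exists2 i, (i <= n)%N & f i = t].

Definition returns t n : set (nat -> S) :=
  [set f | exists2 i, (0 < i <= n)%N & f i = t].

Definition hits_after t j : set (nat -> S) :=
  [set f | exists2 i, (j <= i)%N & f i = t].

Lemma measurable_returns t n : measurable_event M (returns t n).
Proof.
apply: (@measurable_event_determined _ _ _ n) => f g fg [i /andP[i0 ni] fi].
by exists i; rewrite ?i0// -fg.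
Qed.

Lemma measurable_hits_after t j : measurable_event M (hits_after t j).
Proof.
rewrite (_ : hits_after t j = \bigcup_i [set f | (j <= i)%N /\ f i = t]).
  apply: measurable_event_bigcup => i; apply: (@measurable_event_determined _ _ _ i).
  by move=> f g fg [ji fi]; split=> //; rewrite -fg.
by apply/seteqP; split=> f; [case=> i ji fi; exists i|case=> i _ [ji fi]; exists i].
Qed.

Lemma returns_scons s t n : [set f | returns t n.+1 (scons s f)] = hits t n.
Proof.
apply/seteqP; split=> f.
  by case=> -[//|i] /= ni fi; exists i.
by case=> i ni fi; exists i.+1.
Qed.

Lemma hits_after_scons s t j : [set f | hits_after t j.+1 (scons s f)] = hits_after t j.
Proof.
apply/seteqP; split=> f.
  by case=> -[//|i] /= ji fi; exists i.
by case=> i ji fi; exists i.+1.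
Qed.

Lemma pr_hits_start sigma t n : pr sigma t (hits t n) = 1.
Proof. by apply: pr_sure => r; exists 0%N => //; exact: run_start. Qed.

Lemma pr_hits_other sigma s t n : s != t ->
  pr sigma s (hits t n) = pr sigma s (returns t n).
Proof.
move=> st; apply: eq_pr => r; split=> -[i].
  case: i => [_|i ni ri]; last by exists i.+1.
  by rewrite run_start => E; rewrite E eqxx in st.
by move=> /andP[_ ni] ri; exists i.
Qed.

End hitting.

Section transience.
Variables (R : realType) (S : countType) (M : mdp R S).
Hypothesis trans : universally_transient M.
Implicit Types (sigma : strategy M) (s t u : S).

Lemma transient_pr0 sigma s E : measurable_event M E ->
  (forall r : run M s, E r -> exists t, ~ finite_set [set i | r i = t]) ->
  pr sigma s E = 0.
Proof.
move=> mE EI; have [N [mN N0 sub]] := trans s sigma.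
apply: EFin_inj; rewrite prE//; apply/eqP; rewrite -measure_le0 -N0.
apply: le_measure; rewrite ?inE//.
by move=> r /EI[t nt]; apply: (sub r) => H; apply: nt; exact: H.
Qed.

(** * Probability of returning to a state *)

Section excursions.
Variables (t : S) (tau : nat -> S -> S).
Hypothesis tauP : forall k s, step M s (tau k s).

Lemma nth_visit_proof m (h : seq S) s :
  step M s (tau (m + count_mem t (rcons h s)) s).
Proof. exact: tauP. Qed.

(* Plays [tau k] between the [k - m]-th and the next visit of [t]. *)
Definition nth_visit m : strategy M := pure (nth_visit_proof m).

Lemma residual_nth_visit m s u : step M s u ->
  agree (residual (nth_visit m) s) (nth_visit (m + (s == t))) u.
Proof.
move=> su; apply: residual_agree => // h x _ _ y.
by rewrite /next_distr /= addnA.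
Qed.

Lemma next_nth_visit m s : next_distr (nth_visit m) [::] s =
  next_distr (md (tauP (m + (s == t)))) [::] s.
Proof. by rewrite /next_distr /= addn0. Qed.

(** Until the next visit of [t] the index [m + (s == t)] does not change, so the play is that of a
    single memoryless strategy; at that visit the bound [b] applies to the rest. The induction is on
    the length [n] allowed for the excursion. *)
Lemma pr_hits_after_ge j n b : 0 <= b -> forall m s,
  b <= pr (nth_visit (m + (s == t))) t (hits_after t j) ->
  b * pr (md (tauP (m + (s == t)))) s (returns t n) <=
  pr (nth_visit m) s (hits_after t j.+1).
Proof.
move=> b0; elim: n => [|n IH] m s bP.
  rewrite (_ : returns t 0 = set0) ?pr_set0 ?mulr0 ?pr_ge0//.
  by apply/seteqP; split=> f // -[i]; rewrite leqn0 => /andP[/lt0n_neq0/negPf->].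
have mr := @measurable_returns R S M t n.+1.
rewrite (pr_step _ _ (@measurable_hits_after R S M t j.+1)) hits_after_scons.
rewrite pr_md_step// returns_scons -avgZ//; last 2 first.
- exact: next_weights.
- exact: bounded0_pr.
rewrite next_nth_visit; apply: le_avg.
- exact: next_weights.
- by apply: bounded0Z => //; exact: bounded0_pr.
- exact: bounded0_pr.
move=> u nz; have su := next_step nz.
rewrite [leRHS](agree_pr _ (residual_nth_visit _ su)).
have [->|ut] := eqVneq u t.
  by rewrite pr_hits_start mulr1.
rewrite pr_hits_other//.
apply: (@le_trans _ _ (pr (nth_visit (m + (s == t))) u (hits_after t j.+1))).
  have := IH (m + (s == t))%N u; rewrite (negPf ut) addn0; exact.
apply: le_pr; try exact: measurable_hits_after.
by move=> f [i ji fi]; exists i => //; exact: ltnW.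
Qed.

End excursions.

(** Otherwise there are memoryless strategies [tau k] that return to [t] with probability above
    [1 - 2^-(k+1)]. Using one for each excursion, [t] is visited infinitely often with probability
    at least one half, against transience. *)
Lemma return_bound t : exists rho : R, [/\ 0 <= rho, rho < 1 &
  forall (f : S -> S) (fP : forall s, step M s (f s)) n,
    pr (md fP) t (returns t n) <= rho].
Proof.
apply: contrapT => H.
have /choice[x xP] : forall k, exists x : {f : S -> S | forall s, step M s (f s)} * nat,
    1 - 2^-1 ^+ k.+1 < pr (md (proj2_sig x.1)) t (returns t x.2).
  move=> k; apply: contrapT => nk; apply: H.
  have p0 : 0 < 2^-1 ^+ k.+1 :> R by rewrite exprn_gt0// invr_gt0.
  have p1 : 2^-1 ^+ k.+1 <= 1 :> R by rewrite exprn_ile1// invf_le1// ler1n.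
  exists (1 - 2^-1 ^+ k.+1); split; [lra|lra|].
  move=> f fP n; rewrite leNgt; apply/negP => fn; apply: nk.
  by exists (exist _ f fP, n).
pose tau k := sval (x k).1.
pose tauP k s : step M s (tau k s) := proj2_sig (x k).1 s.
have lower j m : 1 - 2^-1 ^+ m.+1 <= pr (nth_visit t tauP m) t (hits_after t j).
  elim: j m => [|j IH] m.
    rewrite pr_sure; last by move=> r; exists 0%N => //; exact: run_start.
    by rewrite gerBl exprn_ge0// invr_ge0.
  have p0 : 0 < 2^-1 ^+ m.+2 :> R by rewrite exprn_gt0// invr_gt0.
  have p1 : 2^-1 ^+ m.+2 <= 1 :> R by rewrite exprn_ile1// invf_le1// ler1n.
  have b0 : 0 <= 1 - 2^-1 ^+ m.+2 :> R by lra.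
  have := @pr_hits_after_ge t tau tauP j (x m.+1).2 _ b0 m t.
  rewrite eqxx addn1 => /(_ (IH _)); apply: le_trans.
  (* With [y = 2^-1 ^+ m.+2] this is [(1 - y)^2 >= 1 - 2 y]: one factor is the next excursion, the
     other all later ones. *)
  apply: (@le_trans _ _ ((1 - 2^-1 ^+ m.+2) * (1 - 2^-1 ^+ m.+2))).
    have -> : 2^-1 ^+ m.+1 = 2 * 2^-1 ^+ m.+2 :> R by rewrite [in RHS]exprS mulVKf.
    nra.
  by rewrite ler_wpM2l//; exact: ltW (xP m.+1).
have mV := @measurable_hits_after R S M t.
have : 1 - 2^-1 ^+ 1 <= pr (nth_visit t tauP 0) t (\bigcap_j hits_after t j).
  apply: pr_bigcap => // j f [i ji fi].
  by exists i => //; exact: ltnW.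
rewrite transient_pr0 ?expr1.
- lra.
- exact: measurable_event_bigcap.
move=> r rI; exists t => /finite_nat_bound[n rn].
by have [i ni /rn] := rI n Logic.I; rewrite ltnNge ni.
Qed.

(** * Memoryless strategies that are nearly optimal for safety *)

Section safety.
Variables (c : S -> S -> Prop) (B : S -> S -> Prop).

Definition safe : set (nat -> S) := [set f | forall i, B (f i) (f i.+1)].

Definition safe_upto n : set (nat -> S) :=
  [set f | forall i, (i < n)%N -> B (f i) (f i.+1)].

Lemma measurable_safe_upto n : measurable_event M (safe_upto n).
Proof.
apply: (@measurable_event_determined _ _ _ n) => f g fg Bf i ni.
by rewrite -!fg//; [exact: Bf|exact: ltnW].
Qed.

Lemma safe_bigcap : safe = \bigcap_n safe_upto n.
Proof.
apply/seteqP; split=> f; first by move=> Bf n _ i _; exact: Bf.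
by move=> Bf i; exact: (Bf i.+1).
Qed.

Lemma measurable_safe : measurable_event M safe.
Proof.
by rewrite safe_bigcap; apply: measurable_event_bigcap; exact: measurable_safe_upto.
Qed.

(** The element 0 keeps the set nonempty where no strategy follows [c]. *)
Definition safe_value s : R :=
  sup [set x | x = 0 \/ exists2 sigma : strategy M, follows c sigma s & x = pr sigma s safe].

Lemma safe_value_has_sup s : has_sup
  [set x : R | x = 0 \/ exists2 sigma : strategy M, follows c sigma s & x = pr sigma s safe].
Proof.
split; first by exists 0; left.
by exists 1 => _ [->//|[sigma _ ->]]; exact: pr_le1.
Qed.

Lemma pr_le_safe_value sigma s : follows c sigma s ->
  pr sigma s safe <= safe_value s.
Proof.
move=> fs; apply: ub_le_sup; first by case: (safe_value_has_sup s).
by right; exists sigma.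
Qed.

Lemma safe_value_ge0 s : 0 <= safe_value s.
Proof.
by apply: ub_le_sup; [case: (safe_value_has_sup s)|left].
Qed.

Lemma safe_value_le1 s : safe_value s <= 1.
Proof.
apply: ge_sup; first by case: (safe_value_has_sup s).
by move=> _ [->//|[sigma _ ->]]; exact: pr_le1.
Qed.

Definition safe_next s u : R := if `[< B s u >] then safe_value u else 0.

Lemma bounded0_safe_next s : bounded0 (safe_next s).
Proof.
exists 1 => u; rewrite /safe_next.
by case: ifP => _; rewrite ?lexx ?ler01// safe_value_ge0 safe_value_le1.
Qed.

Lemma pr_safe_le sigma s : follows c sigma s ->
  pr sigma s safe <= avg (next_distr sigma [::] s) (safe_next s).
Proof.
move=> fs; rewrite (pr_step _ _ measurable_safe); apply: le_avg.
- exact: next_weights.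
- exact: bounded0_pr.
- exact: bounded0_safe_next.
move=> u nz; have [_ fu] := follows_step fs nz; rewrite /safe_next.
case: asboolP => [Bu|nBu].
  apply: le_trans (pr_le_safe_value fu).
  rewrite (_ : [set f | safe (scons s f)] = [set f | B s (f 0%N)] `&` safe).
    apply: le_pr; [|exact: measurable_safe|by move=> f []].
    apply: measurable_eventI measurable_safe.
    apply: (@measurable_event_determined _ _ _ 0) => f g fg /=.
    by rewrite fg.
  apply/seteqP; split=> f.
    by move=> Bf; split=> [|i]; [exact: (Bf 0%N)|exact: (Bf i.+1)].
  by move=> [B0 Bf] [|i] //=; exact: Bf.
rewrite (@eq_pr _ _ _ _ u _ set0) ?pr_set0// => r; split=> // Br.
by apply: nBu; have := Br 0%N; rewrite /= run_start.
Qed.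

Definition followable s := exists sigma : strategy M, follows c sigma s.

(** Some successor in the support of a nearly optimal strategy is at least as good as the average,
    so a deterministic move loses at most [eta s]. *)
Lemma safe_choice (eta : S -> R) : (forall s, 0 < eta s) ->
  exists2 tau : S -> S, forall s, step M s (tau s) &
  forall (tauP : forall s, step M s (tau s)) s, followable s ->
    (forall u, next_distr (md tauP) [::] s u != 0 -> c s u /\ followable u) /\
    safe_value s <= avg (next_distr (md tauP) [::] s) (safe_next s) + eta s.
Proof.
move=> eta0.
have /choice[tau tauP] : forall s, exists u, step M s u /\
    (s \in controlled M -> followable s ->
     [/\ c s u, followable u & safe_value s - eta s <= safe_next s u]).
  move=> s; have [[sc [sigma fs]]|nsf] := pselect ((s \in controlled M) /\ followable s);
    last first.
    by have [u su] := step_total M s; exists u; split=> // sc fs; case: nsf; split.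
  have [tau [ft te]] : exists tau : strategy M, follows c tau s /\
      safe_value s - eta s <= pr tau s safe.
    (* The supremum may be approached by the added element 0; then every strategy following [c] will
       do. *)
    have [x [->|[tau ft ->]] xP] := sup_adherent (eta0 s) (safe_value_has_sup s).
      by exists sigma; split=> //; rewrite (le_trans (ltW xP))// pr_ge0.
    by exists tau; split=> //; exact: ltW.
  have [u nz uP] : exists2 u, next_distr tau [::] s u != 0 &
      safe_value s - eta s <= safe_next s u.
    have [x nzx] := distr_support (next_distr1 tau s).
    have [le0|gt0] := leP (safe_value s - eta s) 0.
      exists x => //; apply: le_trans le0 _; rewrite /safe_next.
      by case: ifP => // _; exact: safe_value_ge0.
    (* Otherwise [safe_next s] stays below the constant on the support although its average does
       not, and [avg_eq_le] forces equality. *)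
    apply: contrapT => H.
    have H' u : next_distr tau [::] s u != 0 -> safe_next s u <= safe_value s - eta s.
      by move=> nz; rewrite leNgt; apply/negP => /ltW ?; apply: H; exists u.
    have qw := next_weights tau s.
    apply: H; exists x => //.
    rewrite (@avg_eq_le _ _ _ (safe_next s) (fun=> safe_value s - eta s) qw)//.
    - exact: bounded0_safe_next.
    - by apply: bounded0_cst; exact: ltW.
    - rewrite (avg_cst (next_distr1 _ _) (ltW gt0)).
      exact: le_trans te (pr_safe_le ft).
  have [cu fu] := follows_step ft nz.
  by exists u; split=> [|_ _]; [exact: next_step nz|split=> //; exists (residual tau s)].
exists tau => [s|tauP' s fs]; first by have [] := tauP s.
have [sc|sc] := boolP (s \in controlled M).
  have [_ /(_ sc fs)[cu fu ule]] := tauP s.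
  split=> [u|]; last first.
    rewrite (avg_dirac (t := tau s)); [lra|exact: bounded0_safe_next|].
    by move=> u; rewrite next_pure.
  by rewrite next_pure//; case: (eqVneq u (tau s)) => [->//|_]; rewrite eqxx.
have nE sigma : next_distr (md tauP') [::] s = next_distr sigma [::] s.
  by rewrite /next_distr (negPf sc).
split=> [u|].
  have [sigma fsig] := fs; rewrite (nE sigma) => nz.
  by have [cu fu] := follows_step fsig nz; split=> //; exists (residual sigma s).
have a0 : 0 <= avg (next_distr (md tauP') [::] s) (safe_next s).
  by apply: avg_ge0; [exact: next_weights|exact: bounded0_safe_next].
apply: (@le_trans _ _ (avg (next_distr (md tauP') [::] s) (safe_next s))); last first.
  by have := eta0 s; lra.
apply: ge_sup; first by case: (safe_value_has_sup s).
by move=> _ [->//|[sigma fsig ->]]; rewrite (nE sigma); exact: pr_safe_le.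
Qed.

Lemma md_follows (tau : S -> S) (tauP : forall s, step M s (tau s)) (D : S -> Prop) :
  (forall s, D s -> forall u, next_distr (md tauP) [::] s u != 0 -> c s u /\ D u) ->
  forall s, D s -> follows c (md tauP) s.
Proof.
move=> DP s Ds.
(* Residuals of [md tauP] are compared with it only through [agree], hence this invariant. *)
apply: (follows_coind (P := fun sigma s => D s /\ agree sigma (md tauP) s)); last first.
  by split=> // h t _ _ x.
move=> {Ds}sigma {}s [Ds ag] u nz; have su := next_step nz.
rewrite (ag [::] s)// in nz; have [cu Du] := DP s Ds u nz.
split=> //; split=> // h t ht hu x.
by rewrite (agree_residual su ag)// (residual_md tauP su).
Qed.

(** A visit of [s] may lose [zeta s * (1 - rho s)], and the expected number of visits is at most
    [1 / (1 - rho s)], so the total loss is at most the sum of [zeta]. The proof replaces expected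
    visits by a potential built from hitting probabilities. *)
Lemma safe_md e : 0 < e -> exists (tau : S -> S) (tauP : forall s, step M s (tau s)),
  (forall s, followable s -> follows c (md tauP) s) /\
  (forall sigma s, follows c sigma s -> pr sigma s safe - e <= pr (md tauP) s safe).
Proof.
move=> e0; have /choice[rho rhoP] := return_bound.
(* Geometric weights along the enumeration of [S], of total at most [e]. *)
pose zeta (t : S) : R := e / (2 ^ (pickle t).+1)%:R.
have zeta0 t : 0 < zeta t by rewrite divr_gt0// ltr0n expn_gt0.
have zsum : (\esum_(t in [set: S]) (zeta t)%:E <= e%:E)%E.
  rewrite esum_spread => [|t]; last by rewrite lee_fin ltW.
  apply: le_trans (epsilon_trick0 xpredT (ltW e0)).
  apply: lee_nneseries => [k _ _|k _].
    by apply: spread_ge0 => t; rewrite lee_fin ltW.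
  rewrite /spread; have := @pickle_invK S k.
  case: pickle_inv => [t /= <-//|_].
  by rewrite lee_fin divr_ge0// ltW.
have zw : weights zeta.
  by split=> [t|]; [exact: ltW|exact: le_lt_trans zsum (ltry _)].
have eta0 s : 0 < zeta s * (1 - rho s).
  by rewrite mulr_gt0// subr_gt0; have [] := rhoP s.
have [tau tauP /(_ tauP) tauE] := safe_choice eta0.
exists tau, tauP; split.
  by move=> s; apply: (md_follows (D := followable)) => {}s /tauE[].
pose h n s t := pr (md tauP) s (hits t n).
have hb n s : bounded0 (h n s) by exists 1 => t; rewrite pr_ge0 pr_le1.
(* The potential [avg zeta (h n s)] weighs each state by its probability of being hit within [n]
   steps; it bounds the loss still to come. *)
have main n s : followable s ->
    safe_value s <= pr (md tauP) s (safe_upto n) + avg zeta (h n s).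
  elim: n s => [|n IH] s fs.
    rewrite pr_sure; last by move=> r i; rewrite ltn0.
    by have := safe_value_le1 s; have := avg_ge0 zw (hb 0%N s); lra.
  have [fu sle] := tauE s fs.
  set q := next_distr (md tauP) [::] s in fu sle *.
  have qw : weights q := next_weights (md tauP) s.
  pose r t := pr (md tauP) s (returns t n.+1).
  have rE t : r t = avg q (fun u => h n u t).
    by rewrite /r pr_md_step ?returns_scons//; exact: measurable_returns.
  have rb : bounded0 r by exists 1 => t; rewrite pr_ge0 pr_le1.
  (* By exchange of sums, the average potential after one step is the same expression with returns
     in place of hits. *)
  have step1 : avg q (safe_next s) <= pr (md tauP) s (safe_upto n.+1) + avg zeta r.
    have -> : avg zeta r = avg q (fun u => avg zeta (h n u)).
      rewrite (@avg_exchange _ _ _ q zeta (fun t u => h n u t) 1)//.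
        by apply: eq_avg => // t _; rewrite rE.
      by move=> t u; rewrite pr_ge0 pr_le1.
    rewrite (pr_md_step _ _ (measurable_safe_upto n.+1)) -/q -avgD//; first last.
    - exists (fine (\esum_(t in [set: S]) (zeta t * 1)%:E)%E) => u.
      rewrite avg_ge0//=; apply: le_avg => //; first by exists 1 => _; rewrite ler01 lexx.
      by move=> t _; exact: pr_le1.
    - exact: bounded0_pr.
    apply: le_avg => //; first exact: bounded0_safe_next.
      apply: bounded0D; first exact: bounded0_pr.
      exists (fine (\esum_(t in [set: S]) (zeta t * 1)%:E)%E) => u.
      rewrite avg_ge0//=; apply: le_avg => //; first by exists 1 => _; rewrite ler01 lexx.
      by move=> t _; exact: pr_le1.
    move=> u nz; have [cu fu'] := fu u nz.
    rewrite /safe_next; case: asboolP => [Bu|_]; last first.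
      by rewrite addr_ge0 ?pr_ge0// avg_ge0.
    apply: le_trans (IH u fu') _; rewrite lerD2r.
    rewrite (@eq_pr _ _ _ _ u (safe_upto n) [set f | safe_upto n.+1 (scons s f)])// => p.
    split=> [Bp [|i]|Bp i ni]; last exact: (Bp i.+1).
      by rewrite /= run_start.
    exact: Bp.
  (* At [s] a hit is certain and a return has probability at most [rho s]; this drop of the
     potential pays for the loss at the current visit. *)
  pose d t : R := (1 - rho s) * (t == s)%:R.
  have rho1 : 0 <= 1 - rho s by rewrite subr_ge0 ltW//; have [] := rhoP s.
  have db : bounded0 d.
    by apply: bounded0Z => //; exists 1 => t; rewrite ler0n lern1 leq_b1.
  have step2 : avg zeta r + avg zeta d <= avg zeta (h n.+1 s).
    rewrite -avgD//; apply: le_avg => // [|t _]; first exact: bounded0D.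
    rewrite /d /h; case: (eqVneq t s) => [->|ts].
      rewrite mulr1 pr_hits_start; have [_ _ /(_ _ tauP n.+1)] := rhoP s.
      by rewrite /r; lra.
    by rewrite mulr0 addr0 pr_hits_other// eq_sym.
  have := avg_ge_term s zw db; rewrite /d eqxx mulr1 => step3.
  by lra.
move=> sigma s fs; rewrite safe_bigcap.
apply: pr_bigcap => [|n f Bf i ni|n]; first exact: measurable_safe_upto.
  by apply: Bf; rewrite ltnS ltnW.
have := main n s (ex_intro _ sigma fs); rewrite -safe_bigcap.
have := pr_le_safe_value fs.
have : avg zeta (h n s) <= e.
  rewrite -lee_fin avgE//; apply: le_trans zsum; apply: le_esum => t _.
  by rewrite lee_fin ler_piMr ?pr_le1// ltW.
by lra.
Qed.

End safety.

End transience.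
(** * Fixing memoryless choices *)

Lemma agree_trans (R : realType) (S : countType) (M : mdp R S)
    (sigma tau rho : strategy M) s :
  agree sigma tau s -> agree tau rho s -> agree sigma rho s.
Proof. by move=> st tr h t ht hs x; rewrite st// tr. Qed.

Section plaster.
Variables (R : realType) (S : countType) (M : mdp R S) (phi : set (nat -> S)).
Implicit Types (sigma rho : strategy M) (s t u : S) (c : S -> S -> Prop).
Hypothesis phi_tail : forall s f, phi (scons s f) <-> phi f.
Hypothesis phi_approx : forall sigma s, approximable sigma s phi.
Hypothesis phi_md : forall c sigma s e, follows c sigma s -> 0 < e ->
  exists (tau : S -> S) (tauP : forall s, step M s (tau s)),
  (forall t, followable M c t -> follows c (md tauP) t) /\
  pr sigma s phi - e <= pr (md tauP) s phi.

Local Notation value := (value M phi).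
Local Notation attained := (attained M phi).
Local Notation preserving := (preserving M phi).

Let mphi : measurable_event M phi := measurable_phi phi_approx.

Definition lossless c := (forall s u, c s u -> preserving s u) /\
  forall s e, attained s -> 0 < e ->
    exists sigma, follows c sigma s /\ value s - e <= pr sigma s phi.

(** * Fixing a memoryless strategy where it secures a third of the value *)

Section fix_md.
Variables (c : S -> S -> Prop) (tau : S -> S).
Hypotheses (cL : lossless c) (tauP : forall s, step M s (tau s)).
Hypothesis tau_follows : forall t, followable M c t -> follows c (md tauP) t.

Let p s := pr (md tauP) s phi.

Definition good : set S := [set s | attained s /\ value s <= 3 * p s].

Definition fixed s u := c s u /\ (s \in controlled M -> good s -> u = tau s).

Lemma followable_attained s : attained s -> followable M c s.
Proof. by move=> sW; have [sigma [fs _]] := cL.2 s 1 sW ltr01; exists sigma. Qed.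

Lemma md_follows_fixed s : followable M c s -> follows fixed (md tauP) s.
Proof.
apply: md_follows => {}s fs u nz; have [cu fu] := follows_step (tau_follows fs) nz.
split; last by exists (residual (md tauP) s).
split=> // sc _; move: nz; rewrite next_pure//.
by case: (eqVneq u (tau s)) => // _; rewrite eqxx.
Qed.

(** The test runs over the whole prefix, so that [tau] stays in force after [good] has been left
    again. *)
Lemma until_proof sigma h t : history M h t ->
  is_distr (if has (fun x => `[< good x >]) (rcons h t)
            then fun u => (u == tau t)%:R else sigma h t) (succs M t).
Proof.
move=> ht; case: ifP => _; last exact: choice_distr.
exact: (@dirac_distr R S (tau t) (succs M t) (tauP t)).
Qed.

Definition until sigma : strategy M := Strategy (@until_proof sigma).

Lemma until_good sigma s : good s -> agree (until sigma) (md tauP) s.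
Proof.
move=> gs h t _ hs u; rewrite /next_distr /=; case: ifP => // _.
suff -> : has (fun x => `[< good x >]) (rcons h t) by [].
by case: h hs => [|x h] /= ->; rewrite asboolT.
Qed.

Lemma next_until sigma s : ~ good s ->
  next_distr (until sigma) [::] s = next_distr sigma [::] s.
Proof. by move=> gs; rewrite /next_distr /= asboolF. Qed.

Lemma residual_until sigma s u : step M s u -> ~ good s ->
  agree (residual (until sigma) s) (until (residual sigma s)) u.
Proof.
move=> su gs; apply: residual_agree => // h t ht hu x.
rewrite /next_distr /= asboolF//=; case: ifP => // tc.
case: ifP => // _.
by rewrite /history is_prefix_cons hu su ht tc.
Qed.

Lemma until_follows sigma s : follows c sigma s -> follows fixed (until sigma) s.
Proof.
(* Either [tau] has taken over, or the play is still of the form [until sigma] with [sigma]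
   following [c]. *)
move=> fs; apply: (follows_coind (P := fun rho s => follows fixed rho s \/
  exists2 sigma, follows c sigma s & agree rho (until sigma) s)); last first.
  by right; exists sigma.
move=> {fs}rho {sigma}{}s H u nz.
have {H}[fr|[sigma fs ag]] := H.
  by have [cu fu] := follows_step fr nz; split=> //; left.
have [gs|ngs] := pselect (good s).
  have fr : follows fixed rho s.
    apply: (@follows_agree _ _ _ _ (md tauP)).
      by apply: agree_sym; exact: agree_trans ag (until_good _ gs).
    by apply: md_follows_fixed; exists sigma.
  by have [cu fu] := follows_step fr nz; split=> //; left.
have su := next_step nz.
rewrite (ag [::] s)// next_until// in nz.
have [cu fu] := follows_step fs nz; split; first by split.
right; exists (residual sigma s) => //.
exact: agree_trans (agree_residual su ag) (residual_until _ su ngs).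
Qed.

Definition enters n : set (nat -> S) := [set f | exists2 i, (i <= n)%N & good (f i)].

Lemma measurable_enters n : measurable_event M (phi `&` enters n).
Proof.
apply: measurable_eventI => //; apply: (@measurable_event_determined _ _ _ n).
by move=> f g fg [i ni gi]; exists i => //; rewrite -fg.
Qed.

Lemma enters_scons s n : ~ good s ->
  [set f | (phi `&` enters n.+1) (scons s f)] = phi `&` enters n.
Proof.
move=> gs; rewrite -[in RHS](tail_phi phi_tail s); apply/seteqP; split=> f.
  by case=> ph [[|i] //= ni gi]; split=> //; exists i.
by case=> ph [i ni gi]; split=> //; exists i.+1.
Qed.

(** On entering [good], [tau] secures a third of the value, hence of whatever [sigma] would obtain
    from there. *)
Lemma pr_until_enters n sigma s : follows c sigma s -> attained s ->
  pr sigma s (phi `&` enters n) <= 3 * pr (until sigma) s (phi `&` enters n).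
Proof.
elim: n sigma s => [|n IH] sigma s fs sW; have [gs|ngs] := pselect (good s).
(* Goals 1 and 3 are those with a start in [good], where [enters] holds at time 0. *)
1,3: have E tau' m : pr tau' s (phi `&` enters m) = pr tau' s phi.
1,3: by apply: eq_pr => r; split=> [[]//|ph]; split=> //; exists 0%N => //;
        rewrite run_start.
1,2: rewrite !E (agree_pr _ (until_good _ gs)).
1,2: by apply: le_trans (proj2 gs); exact: pr_le_value.
  rewrite (@eq_pr _ _ _ _ _ _ set0) ?pr_set0 ?mulr_ge0 ?pr_ge0// => r.
  by split=> // -[_ [i]]; rewrite leqn0 => /eqP ->; rewrite run_start.
have mE := measurable_enters n.+1.
rewrite !(pr_step _ _ mE) enters_scons// next_until//.
have qw := next_weights sigma s.
rewrite -avgZ//; last exact: bounded0_pr.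
apply: le_avg => //; [exact: bounded0_pr|by apply: bounded0Z => //; exact: bounded0_pr|].
move=> u nz; have su := next_step nz; have [cu fu] := follows_step fs nz.
have [_ uW _] := cL.1 s u cu.
by rewrite [X in 3 * X](agree_pr _ (residual_until _ su ngs)); exact: IH.
Qed.

(** Take [sigma] securing three quarters of the value. Its runs that avoid [good] are not affected
    by [until], and those that enter lose at most a factor 3, which leaves the quarter that [boost]
    asks for. *)
Lemma fixed_good s : attained s ->
  exists sigma, follows fixed sigma s /\ value s <= 4 * pr sigma s phi.
Proof.
move=> sW; have v0 := value_ge0 M phi s.
have [sigma [fs vs]] : exists sigma, follows c sigma s /\
    3 * value s <= 4 * pr sigma s phi.
  have [v00|v00] := eqVneq (value s) 0.
    have [sigma fs] := followable_attained sW; exists sigma; split=> //.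
    by rewrite v00 mulr0 mulr_ge0// pr_ge0.
  have e0 : 0 < value s / 4 by rewrite divr_gt0// lt_neqAle eq_sym v00.
  have [sigma [fs vs]] := cL.2 s _ sW e0; exists sigma; split=> //; lra.
exists (until sigma); split; first exact: until_follows.
have mS := @measurable_stay R S M (~` good).
have stE rho : pr rho s phi = pr rho s (phi `&` stay (~` good)) +
    pr rho s (\bigcup_n (phi `&` enters n)).
  rewrite (pr_split rho s mphi mS); congr (_ + pr _ _ _).
  apply/seteqP; split=> f.
    move=> [ph nst]; apply: contrapT => H; apply: nst => i gi; apply: H.
    by exists i => //; split=> //; exists i.
  by move=> [n _ [ph [i _ gi]]]; split=> // H; exact: (H i).
rewrite (stE (until sigma)); have := stE sigma.
have -> : pr (until sigma) s (phi `&` stay (~` good)) =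
    pr sigma s (phi `&` stay (~` good)).
  apply: agree_within_pr => // h t ht hs hg.
  apply/funext => u; rewrite /next_distr /=; case: ifP => // _; case: ifPn => //.
  by move=> /hasP[x xh /asboolP gx]; have := hg x xh.
have st0 := pr_ge0 sigma s (phi `&` stay (~` good)).
suff : pr sigma s (\bigcup_n (phi `&` enters n)) <=
    3 * pr (until sigma) s (\bigcup_n (phi `&` enters n)) by lra.
apply/ler_addgt0Pr => e e0.
have [||k kP] := @pr_bigcup _ _ M s (fun n => phi `&` enters n) e _ _ e0 sigma.
- exact: measurable_enters.
- by move=> n f [ph [i ni gi]]; split=> //; exists i => //; exact: leqW.
apply: le_trans (ltW kP) _; rewrite lerD2r.
apply: le_trans (pr_until_enters k fs sW) _; rewrite ler_pM2l//.
apply: le_pr; [exact: measurable_enters|exact: measurable_event_bigcup measurable_enters|].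
by move=> f; exists k.
Qed.

Lemma fixed_lossless : lossless fixed.
Proof.
split=> [s u [cu _]|s e sW e0]; first exact: cL.1.
apply: (boost phi_tail phi_approx (c := fixed)) => //.
- by move=> t u [cu _]; exact: cL.1.
- exact: fixed_good.
Qed.

Definition stays_upto n : set (nat -> S) := [set f | forall i, (i <= n)%N -> good (f i)].

Lemma measurable_stays_upto n : measurable_event M (phi `&` stays_upto n).
Proof.
apply: measurable_eventI => //; apply: (@measurable_event_determined _ _ _ n).
by move=> f g fg gf i ni; rewrite -fg//; exact: gf.
Qed.

(** Stop at the first exit from [good], or at time [n]. On exit, [3 * p] is below [value]; without
    exit, [value] still covers [p] once. As [value] is a martingale, only twice the probability of
    [phi] without exit is left to add. *)
Lemma pr_stays_upto n s : attained s ->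
  3 * p s <= value s + 2 * pr (md tauP) s (phi `&` stays_upto n).
Proof.
elim: n s => [|n IH] s sW; have [gs|ngs] := pselect (good s); last 1 first.
- have := pr_ge0 (md tauP) s (phi `&` stays_upto n.+1).
  have : value s > 3 * p s by rewrite ltNge; apply/negP => ?; exact: ngs.
  by lra.
- rewrite (@eq_pr _ _ _ _ _ _ phi).
    by have := pr_le_value phi (md tauP) s; rewrite -/(p s); lra.
  move=> r; split=> [[]//|ph]; split=> // i; rewrite leqn0 => /eqP ->.
  by rewrite run_start.
- have := pr_ge0 (md tauP) s (phi `&` stays_upto 0).
  have : value s > 3 * p s by rewrite ltNge; apply/negP => ?; exact: ngs.
  by lra.
have fs := tau_follows (followable_attained sW).
have fp : follows preserving (md tauP) s by apply: follows_mono fs => x y; exact: cL.1.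
rewrite {1}/p (pr_md_step _ _ mphi) (tail_phi phi_tail).
rewrite (pr_md_step _ _ (measurable_stays_upto n.+1)).
have -> : [set f | (phi `&` stays_upto n.+1) (scons s f)] = phi `&` stays_upto n.
  rewrite -[in RHS](tail_phi phi_tail s); apply/seteqP; split=> f [ph gf]; split=> //.
    by move=> i ni; exact: (gf i.+1).
  by move=> [|i] ni //; exact: gf.
rewrite -(preserving_avg_value phi_tail phi_approx sW fp).
have qw := next_weights (md tauP) s.
have b1 := bounded0_pr (fun=> md tauP) (fun=> phi).
have b2 := bounded0_pr (fun=> md tauP) (fun=> phi `&` stays_upto n).
have bv := bounded0_value M phi.
rewrite -!avgZ// -avgD//; last exact: bounded0Z.
apply: le_avg => //; [exact: bounded0Z|by apply: bounded0D => //; exact: bounded0Z|].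
move=> u nz; have [cu _] := follows_step fs nz.
by have [_ uW _] := cL.1 s u cu; exact: IH.
Qed.

(** A memoryless strategy obeying [fixed] plays [tau] throughout [good], so runs that stay there
    keep their probability. By [pr_stays_upto] this is at least [(3 * p s - value s) / 2], which is
    three quarters of the value once [p s] is five sixths of it. *)
Lemma fixed_md (tau' : S -> S) (tauP' : forall s, step M s (tau' s)) s :
  attained s -> 5 * value s <= 6 * p s ->
  (forall t, attained t -> t \in controlled M -> fixed t (tau' t)) ->
  3 * value s <= 4 * pr (md tauP') s phi.
Proof.
move=> sW vp fx; have mS := @measurable_stay R S M good.
have : pr (md tauP') s (phi `&` stay good) <= pr (md tauP') s phi.
  by apply: le_pr => //; exact: measurable_eventI.
have -> : pr (md tauP') s (phi `&` stay good) = pr (md tauP) s (phi `&` stay good).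
  apply: agree_within_pr => // h t _ _ hg; apply/funext => u.
  rewrite /next_distr /=; case: ifP => // tc.
  have gt : good t by apply: hg; rewrite mem_rcons mem_head.
  by have [_ -> //] := fx t gt.1 tc.
have -> : phi `&` stay good = \bigcap_n (phi `&` stays_upto n).
  apply/seteqP; split=> f; first by move=> [ph gf] n _; split=> // i _; exact: (gf i).
  move=> H; split=> [|n]; first by have [] := H 0%N Logic.I.
  by have [_] := H n Logic.I; exact.
have : (3 * p s - value s) / 2 <= pr (md tauP) s (\bigcap_n (phi `&` stays_upto n)).
  apply: pr_bigcap.
  - exact: measurable_stays_upto.
  - by move=> n f [ph gf]; split=> // i ni; apply: gf; exact: leqW.
  - by move=> n; have := pr_stays_upto n sW; lra.
by lra.
Qed.

End fix_md.

Lemma lossless_preserving : lossless preserving.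
Proof.
split=> // s e [sigma os] e0; exists sigma; split.
  exact: optimal_follows phi_tail phi_approx _ _ os.
by rewrite os; lra.
Qed.

(** One stage of the construction. [tau] secures more than a third at [s], so [s] lies in [good] and
    its move gets fixed; the last clause protects three quarters of the value at [s] against all
    later stages. *)
Lemma plaster c s : lossless c -> attained s -> exists c', [/\ lossless c',
  forall t u, c' t u -> c t u,
  s \in controlled M -> forall u u', c' s u -> c' s u' -> u = u' &
  forall (tau : S -> S) (tauP : forall s, step M s (tau s)),
    (forall t, attained t -> t \in controlled M -> c' t (tau t)) ->
    3 * value s <= 4 * pr (md tauP) s phi].
Proof.
move=> cL sW; have v0 := value_ge0 M phi s.
have [tau [tauP [ft vt]]] : exists (tau : S -> S) (tauP : forall s, step M s (tau s)),
    (forall t, followable M c t -> follows c (md tauP) t) /\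
    5 * value s <= 6 * pr (md tauP) s phi.
  (* A twelfth is lost on [sigma] and another on [tau], which leaves five sixths; if the value is
     zero, any positive loss will do. *)
  have e0 : 0 < (if value s == 0 then 1 else value s / 12).
    by case: eqVneq => // v00; rewrite divr_gt0// lt_neqAle eq_sym v00.
  have [sigma [fs vs]] := cL.2 s _ sW e0.
  have [tau [tauP [ft tv]]] := phi_md fs e0; exists tau, tauP; split=> //.
  move: vs tv; have := pr_ge0 (md tauP) s phi.
  by case: eqVneq => [->|_]; lra.
exists (fixed c tauP); split.
- exact: fixed_lossless.
- by move=> t u [].
- move=> sc u u' [_ /(_ sc) uE] [_ /(_ sc) uE'].
  have gs : good tauP s by split=> //; lra.
  by rewrite uE// uE'.
- by move=> tau' tauP' fx; exact: (fixed_md cL ft).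
Qed.

(** The stages leave one move at each controlled state where the value is attained. The resulting
    strategy secures three quarters of the value, so [boost] applies to its own moves, and these
    determine the law. *)
Lemma optimal_md : exists (tau : S -> S) (tauP : forall s, step M s (tau s)),
  forall s, attained s -> pr (md tauP) s phi = value s.
Proof.
have /choice[F FP] : forall cs : (S -> S -> Prop) * S, exists c',
    lossless cs.1 -> attained cs.2 -> [/\ lossless c',
    forall t u, c' t u -> cs.1 t u,
    cs.2 \in controlled M -> forall u u', c' cs.2 u -> c' cs.2 u' -> u = u' &
    forall (tau : S -> S) (tauP : forall s, step M s (tau s)),
      (forall t, attained t -> t \in controlled M -> c' t (tau t)) ->
      3 * value cs.2 <= 4 * pr (md tauP) cs.2 phi].
  move=> [c s] /=; have [[cL sW]|H] := pselect (lossless c /\ attained s).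
    by have [c' c'P] := plaster cL sW; exists c'.
  by exists c => cL sW; case: H.
pose next c n := if @pickle_inv S n is Some t then
  (if `[< attained t >] then F (c, t) else c) else c.
(* Stage [m] treats the state with code [m], if there is one and its value is attained. *)
pose cs := fix cs n := if n is m.+1 then next (cs m) m else preserving.
have csL n : lossless (cs n).
  elim: n => [|n IH] /=; first exact: lossless_preserving.
  rewrite /next; case: pickle_inv => // t; case: asboolP => // tW.
  by have [] := FP (cs n, t) IH tW.
have csS n s u : cs n.+1 s u -> cs n s u.
  rewrite /= /next; case: pickle_inv => // t; case: asboolP => // tW.
  by have [_ + _ _] := FP (cs n, t) (csL n) tW; exact.
have csM m n s u : (m <= n)%N -> cs n s u -> cs m s u.
  move=> /subnK <-; elim: (n - m)%N => // k IH.
  by rewrite addSn => /csS.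
have csE s : attained s -> cs (pickle s).+1 = F (cs (pickle s), s).
  by move=> sW; rewrite /= /next pickleK_inv asboolT.
have ex n s : attained s -> exists2 u, step M s u & cs n s u.
  move=> sW; have [sigma [fs _]] := (csL n).2 s 1 sW ltr01.
  have [u nz] := distr_support (next_distr1 sigma s).
  by exists u; [exact: next_step nz|have [] := follows_step fs nz].
(* After stage [pickle s] one move is left at [s]; as every later stage is lossless and leaves some
   move, it must be this one. *)
have /choice[tau tauE] : forall s, exists u, step M s u /\
    (attained s -> s \in controlled M -> forall n, cs n s u).
  move=> s; have [sW|nW] := pselect (attained s); last first.
    by have [u su] := step_total M s; exists u; split.
  have [u su cu] := ex (pickle s).+1 s sW; exists u; split=> // _ sc n.
  have [/csM|/ltnW ns] := leqP n (pickle s).+1; first exact.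
  have [u' _ cu'] := ex n s sW.
  have := csM _ _ _ _ ns cu'; move: cu; rewrite csE// => cu cu''.
  have [_ _ /(_ sc) uni _] := FP (cs (pickle s), s) (csL _) sW.
  by rewrite (uni u u').
pose tauP s := (tauE s).1; exists tau, tauP => s sW.
have tau_cs n t : attained t -> t \in controlled M -> cs n t (tau t).
  by move=> tW tc; exact: (tauE t).2.
have tau34 t : attained t -> 3 * value t <= 4 * pr (md tauP) t phi.
  move=> tW; have [_ _ _] := FP (cs (pickle t), t) (csL _) tW; apply=> x xW xc.
  by rewrite -csE//; exact: tau_cs.
(* With only the moves of [tau] allowed, the nearly optimal strategies given by [boost] have the
   same law as [md tauP]. *)
pose c t u := preserving t u /\ (t \in controlled M -> u = tau t).
have tau_c t : attained t -> follows c (md tauP) t.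
  apply: md_follows => {}t tW u nz.
  suff pu : preserving t u.
    split; last by case: pu.
    split=> // tc; move: nz; rewrite next_pure//.
    by case: (eqVneq u (tau t)) => // _; rewrite eqxx.
  have [tc|tc] := boolP (t \in controlled M).
    move: nz; rewrite next_pure//; case: (eqVneq u (tau t)) => [->|_]; last by rewrite eqxx.
    by move=> _; exact: (tau_cs 0%N).
  have [sigma os] := tW; have fs := optimal_follows phi_tail phi_approx os.
  have nz' : next_distr sigma [::] t u != 0.
    by move: nz; rewrite /next_distr (negPf tc).
  by have [] := follows_step fs nz'.
apply/eqP; rewrite eq_le pr_le_value//=; apply/ler_addgt0Pr => e e0.
have [||sigma [fs vs]] := boost phi_tail phi_approx (c := c) _ _ sW e0.
- by move=> t u [].
- move=> t tW; exists (md tauP); split; first exact: tau_c.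
  by have := tau34 t tW; have := value_ge0 M phi t; lra.
rewrite -(follows_det_pr phi _ fs (tau_c s sW)); first by lra.
by move=> t u u' tc [_ /(_ tc) ->] [_ /(_ tc) ->].
Qed.

End plaster.
(** * The objective of the theorem *)

Section limit_event.
Variables (R : realType) (S : countType) (M : mdp R S) (A : nat -> set (S * S)).
Hypothesis A_decreasing : forall i j, (i <= j)%N -> A j `<=` A i.
Implicit Types (sigma : strategy M) (s t : S) (f : nat -> S).

Definition in_between i n N : set (nat -> S) :=
  [set f | forall m, (n <= m <= N)%N -> A i (f m, f m.+1)].

Definition limit_event : set (nat -> S) :=
  \bigcap_i \bigcup_n \bigcap_N in_between i n N.

Lemma limit_eventP f : limit_event f <->
  forall i, exists n, forall m, (n <= m)%N -> A i (f m, f m.+1).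
Proof.
split=> [H i|H i _]; have := H i.
  by move=> [//|n _ nA]; exists n => m nm; apply: (nA m); rewrite // nm leqnn.
by move=> [n nA]; exists n => // N _ m /andP[nm _]; exact: nA.
Qed.

Lemma event_limit s : event M s limit_event = \bigcap_i FG M s (A i).
Proof.
apply/seteqP; split=> r.
  by move=> /limit_eventP rA i _; have [n nA] := rA i; exists n.
by move=> rA; apply/limit_eventP => i; have [n _ nA] := rA i Logic.I; exists n.
Qed.

Lemma limit_event_tail s f : limit_event (scons s f) <-> limit_event f.
Proof.
split=> /limit_eventP H; apply/limit_eventP => i; have [n nA] := H i.
  by exists n => m nm; exact: (nA m.+1 (leqW nm)).
by exists n.+1 => -[|m] //= nm; exact: nA.
Qed.

(** [in_between i n N] reads the states up to time [N.+1], and [limit_event] arises from it by three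
    monotone limits; the outermost is monotone because [A] decreases. *)
Lemma limit_event_approx sigma s : approximable sigma s limit_event.
Proof.
apply: approximable_bigcap => [i|i f [n _ nA]]; last first.
  by exists n => // N _ m mN; apply: (A_decreasing (leqnSn i)); exact: (nA N).
apply: approximable_bigcup => [n|n f nA N _ m /andP[nm mN]]; last first.
  by apply: (nA N Logic.I); rewrite mN ltnW.
apply: approximable_bigcap => [N|N f nA m /andP[nm mN]]; last first.
  by apply: nA; rewrite nm leqW.
apply: (@approximable_determined _ _ _ _ _ N.+1) => f g fg nA m /andP[nm mN].
by rewrite -(fg m (leqW mN)) -(fg m.+1 mN); apply: nA; rewrite nm.
Qed.

(** Violations of [A i] are confined to finitely many start states; under transience this leaves
    only finitely many of them. *)
Definition outside_below i k : set (nat -> S) :=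
  [set f | forall m, A i (f m, f m.+1) \/ (pickle (f m) < k)%N].

Lemma measurable_outside_below i k : measurable_event M (outside_below i k).
Proof.
rewrite (_ : outside_below i k = \bigcap_m
    [set f | A i (f m, f m.+1) \/ (pickle (f m) < k)%N]).
  apply: measurable_event_bigcap => m; apply: (@measurable_event_determined _ _ _ m.+1).
  by move=> f g fg; rewrite /mkset !fg.
by apply/seteqP; split=> f fA m; [move=> _; exact: fA|exact: fA].
Qed.

Lemma limit_event_outside i f : limit_event f -> exists k, outside_below i k f.
Proof.
move=> /limit_eventP/(_ i)[n nA]; exists (\max_(m < n) pickle (f m)).+1 => m.
have [/nA|mn] := leqP n m; first by left.
by right; rewrite ltnS (leq_bigmax (Ordinal mn)).
Qed.

Let mL : measurable_event M limit_event :=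
  measurable_phi limit_event_approx.

Lemma pr_outside sigma s i e : 0 < e ->
  exists k, pr sigma s (limit_event `\` outside_below i k) <= e.
Proof.
move=> e0; pose F k := limit_event `&` outside_below i k.
have mF k : measurable_event M (F k).
  by apply: measurable_eventI => //; exact: measurable_outside_below.
have FS k : F k `<=` F k.+1.
  by move=> f [fL fk]; split=> // m; have [|/leqW] := fk m; [left|right].
have [k] := pr_bigcup s mF FS e0 sigma.
have -> : \bigcup_k F k = limit_event.
  apply/seteqP; split=> f; first by case=> ? _ [].
  by move=> fL; have [k' fk] := limit_event_outside i fL; exists k'.
rewrite (pr_split sigma s mL (measurable_outside_below i k)) => H; exists k.
by move: H; rewrite /F; lra.
Qed.

(** One condition on single transitions for all [i] at once, so that [safe_md] applies. *)
Definition escapes (k : nat -> nat) (s t : S) : Prop :=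
  forall i, A i (s, t) \/ (pickle s < k i)%N.

Lemma pr_escapes sigma s e : 0 < e -> exists k : nat -> nat,
  pr sigma s limit_event - e <= pr sigma s (safe (escapes k)).
Proof.
move=> e0.
(* The threshold for [A i] may cost [e / 2^(i+1)]; [Z j] below imposes the first [j] thresholds. *)
have d0 i : 0 < e * 2^-1 ^+ i.+1 by rewrite mulr_gt0// exprn_gt0// invr_gt0.
have /choice[k kP] := fun i => pr_outside sigma s i (d0 i).
exists k; pose Z j := [set f | limit_event f /\
  forall i, (i < j)%N -> outside_below i (k i) f].
have ZS j : Z j.+1 = Z j `&` outside_below j (k j).
  apply/seteqP; split=> f.
    by move=> [fL fj]; split; [split=> // i ij; apply: fj; exact: leqW|exact: fj].
  move=> [[fL fj] fk]; split=> // i; rewrite ltnS leq_eqVlt => /orP[/eqP->//|].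
  exact: fj.
have mZ j : measurable_event M (Z j).
  elim: j => [|j IH]; last first.
    by rewrite ZS; apply: measurable_eventI => //; exact: measurable_outside_below.
  by rewrite (_ : Z 0%N = limit_event)//; apply/seteqP; split=> f; [case|].
have mU i k' : measurable_event M (outside_below i k') by exact: measurable_outside_below.
have lower j : pr sigma s limit_event - e * (1 - 2^-1 ^+ j) <= pr sigma s (Z j).
  elim: j => [|j IH].
    rewrite expr0 subrr mulr0 subr0 (_ : Z 0%N = limit_event)//.
    by apply/seteqP; split=> f; [case|].
  have : pr sigma s (Z j) <=
      pr sigma s (Z j.+1) + pr sigma s (limit_event `\` outside_below j (k j)).
    apply: pr_subadd => //; first exact: measurable_eventD.
    move=> f fZ; have [fk|nfk] := pselect (outside_below j (k j) f).
      by left; rewrite ZS.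
    by right; split=> //; exact: fZ.1.
  have := kP j; rewrite exprS.
  have : 0 < 2^-1 ^+ j :> R by rewrite exprn_gt0// invr_gt0.
  by nra.
have : pr sigma s limit_event - e <= pr sigma s (\bigcap_j Z j).
  apply: pr_bigcap => // [j f|j]; first by rewrite ZS => -[].
  apply: le_trans (lower j); rewrite lerD2l lerN2.
  apply: ler_piMr; first exact: ltW.
  by rewrite gerBl exprn_ge0// invr_ge0.
move=> /le_trans; apply; apply: le_pr; first exact: measurable_event_bigcap.
  exact: measurable_safe.
by move=> f fZ m i; have [_ /(_ _ (ltnSn i))] := fZ i.+1 Logic.I; exact.
Qed.

Lemma finite_visits_escape (f : nat -> S) k :
  (forall t, finite_set [set i | f i = t]) ->
  exists n, forall m, (n <= m)%N -> (k <= pickle (f m))%N.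
Proof.
move=> fin; elim: k => [|k [n IH]]; first by exists 0%N.
have [n' H] : exists n', forall m, (n' <= m)%N -> pickle (f m) != k.
  case E : (@pickle_inv S k) => [t|]; last first.
    by exists 0%N => m _; apply/eqP => fk; rewrite -fk pickleK_inv in E.
  have [n' n'P] := finite_nat_bound (fin t); exists n' => m n'm.
  apply/eqP => fk; move: E; rewrite -fk pickleK_inv => -[/n'P].
  by rewrite ltnNge n'm.
exists (maxn n n') => m; rewrite geq_max => /andP[nm n'm].
by rewrite ltn_neqAle eq_sym H// IH.
Qed.

Hypothesis trans : universally_transient M.

(** Half of [e] pays for the passage to safety, half for [safe_md]. Conversely, almost every safe
    run satisfies the objective, since it leaves each finite set of states for good. *)
Lemma limit_event_md c sigma s e : follows c sigma s -> 0 < e ->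
  exists (tau : S -> S) (tauP : forall s, step M s (tau s)),
  (forall t, followable M c t -> follows c (md tauP) t) /\
  pr sigma s limit_event - e <= pr (md tauP) s limit_event.
Proof.
move=> fs e0; have e20 : 0 < e / 2 by rewrite divr_gt0.
have [k kP] := pr_escapes sigma s e20.
have [tau [tauP [ft tk]]] := safe_md trans c (escapes k) e20.
exists tau, tauP; split=> //; have := tk _ _ fs.
have mS := @measurable_safe R S M (escapes k).
rewrite (pr_split (md tauP) s mS mL).
rewrite (@transient_pr0 _ _ _ trans _ _ (safe (escapes k) `\` limit_event)).
- have : pr (md tauP) s (safe (escapes k) `&` limit_event) <=
      pr (md tauP) s limit_event by apply: le_pr => //; exact: measurable_eventI.
  by lra.
- exact: measurable_eventD.
move=> r [rs nr]; apply: contrapT => H; apply: nr; apply/limit_eventP => i.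
have [n nP] : exists n, forall m, (n <= m)%N -> (k i <= pickle (r m))%N.
  apply: finite_visits_escape => t; apply: contrapT => nt; apply: H.
  by exists t.
exists n => m /nP; have [//|] := rs m i.
by move=> rk; rewrite leqNgt rk.
Qed.

Lemma value_valE s : (value M limit_event s)%:E = val_of (\bigcap_i FG M s (A i)).
Proof.
have E sigma : run_law sigma s (\bigcap_i FG M s (A i)) = (pr sigma s limit_event)%:E.
  by rewrite prE; [rewrite event_limit|exact: mL].
apply/eqP; rewrite eq_le; apply/andP; split; last first.
  by apply: ge_ereal_sup => _ [sigma _ <-]; rewrite E lee_fin pr_le_value.
apply/lee_addgt0Pr => e e0; have [sigma sv] := value_near M limit_event s e0.
apply: (@le_trans _ _ ((pr sigma s limit_event)%:E + e%:E)%E).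
  by rewrite -EFinD lee_fin; lra.
by rewrite leeD2r// -E; apply: ereal_sup_ubound; exists sigma.
Qed.

Lemma optimal_pr sigma s : optimal (\bigcap_i FG M s (A i)) sigma <->
  pr sigma s limit_event = value M limit_event s.
Proof.
rewrite /optimal -value_valE -event_limit -prE; last exact: mL.
by split=> [[]|->].
Qed.

Theorem transient_optimal_md s :
  (exists sigma : strategy M, optimal (\bigcap_i FG M s (A i)) sigma) ->
  exists (tau : S -> S) (tauP : forall s, step M s (tau s)),
    optimal (\bigcap_i FG M s (A i)) (md tauP).
Proof.
move=> [sigma /optimal_pr os].
have [tau [tauP tauO]] :=
  optimal_md limit_event_tail limit_event_approx limit_event_md.
exists tau, tauP; apply/optimal_pr; apply: tauO; by exists sigma.
Qed.

End limit_event.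
(** * Step counter *)

Section step_counter.
Variables (R : realType) (S : countType) (M : mdp R S).

Lemma sub_distr (T : countType) (p : T -> R) D D' : D `<=` D' -> is_distr p D -> is_distr p D'.
Proof. by move=> DD' [p0 pD p1]; split=> // t nD'; apply: pD => /DD'. Qed.

Definition counted_step : rel (S * nat) :=
  fun x y => step M x.1 y.1 && (y.2 == x.2.+1).

Definition counted (n : nat) (p : S -> R) (y : S * nat) : R :=
  (y.2 == n)%:R * p y.1.

Lemma esum_counted n (a : S * nat -> \bar R) : (forall y, y.2 != n -> a y = 0%E) ->
  (\esum_(y in [set: S * nat]) a y = \esum_(t in [set: S]) a (t, n))%E.
Proof.
move=> an; rewrite -(esum_image setT (fun t => (t, n))) => [|x y _ _ []//].
rewrite [RHS]esum_mkcond; apply: eq_esum => -[t m] _; case: ifPn => //.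
rewrite notin_setE => nt; apply: an => /=; apply/eqP => mn.
by apply: nt; exists t; rewrite ?mn.
Qed.

Lemma counted_distr n p D : is_distr p D ->
  is_distr (counted n p) [set y | D y.1 /\ y.2 = n].
Proof.
move=> [p0 pD p1]; split=> [y|[t m] /= nD|].
- by rewrite mulr_ge0.
- rewrite /counted /=; case: eqP => [mn|_]; last by rewrite mul0r.
  by rewrite pD ?mulr0// => Dt; apply: nD.
- rewrite (@esum_counted n) => [|y /negPf yn]; last by rewrite /counted yn mul0r.
  by rewrite -p1; apply: eq_esum => t _; rewrite /counted eqxx mul1r.
Qed.

Lemma counted_step_total x : exists y, counted_step x y.
Proof.
by have [t xt] := step_total M x.1; exists (t, x.2.+1); rewrite /counted_step xt eqxx.
Qed.

Lemma counted_prob_distr (x : S * nat) : x \notin [pred x | x.1 \in controlled M] ->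
  is_distr (counted x.2.+1 (prob M x.1)) [set y | counted_step x y].
Proof.
move=> xc; have xc1 : x.1 \notin controlled M by [].
apply: sub_distr (counted_distr x.2.+1 (prob_distr xc1)).
by move=> y /= [xy yx]; rewrite /counted_step xy yx eqxx.
Qed.

Definition counter : mdp R (S * nat)%type :=
  MDP counted_step_total counted_prob_distr.

Lemma run_counter x (r : run counter x) i : (r i).2 = (x.2 + i)%N.
Proof.
elim: i => [|i IH]; first by rewrite run_start addn0.
by have /andP[_ /eqP ->] := run_step r i; rewrite IH addnS.
Qed.

(** The counter shows the time elapsed, so no state is visited twice. *)
Lemma counter_transient : universally_transient counter.
Proof.
move=> x sigma; apply: aeW => r t.
apply: (@sub_finite_set _ _ [set (t.2 - x.2)%N]); last exact: finite_set1.
by move=> i /= <-; rewrite run_counter addKn.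
Qed.

Definition numbered (n : nat) (w : seq S) : seq (S * nat) := zip w (iota n (size w)).

Lemma numbered_rcons n h s :
  numbered n (rcons h s) = rcons (numbered n h) (s, n + size h)%N.
Proof. by rewrite /numbered size_rcons -addn1 iotaD cats1 zip_rcons ?size_iota. Qed.

Lemma map_fst_numbered n h : map fst (numbered n h) = h.
Proof. by rewrite -/(unzip1 _) unzip1_zip ?size_iota. Qed.

Lemma is_prefix_numbered h s : is_prefix M h s ->
  is_prefix counter (numbered 0 h) (s, size h).
Proof.
elim/last_ind: h s => // h t IH s; rewrite is_prefix_rcons => /andP[ht ts].
rewrite numbered_rcons is_prefix_rcons IH//= /counted_step /=.
by rewrite ts size_rcons eqxx.
Qed.

Lemma is_prefix_fst h x : is_prefix counter h x -> is_prefix M (map fst h) x.1.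
Proof.
rewrite /is_prefix -map_rcons sorted_map; apply: sub_sorted => y z.
by move=> /andP[].
Qed.

(** Only prefixes with the counter started at 0 are compared; no others occur in runs from
    [(s, 0)]. *)
Definition corresponds (sigma : strategy M) (sigma' : strategy counter) :=
  forall h s t, is_prefix M h s ->
  next_distr sigma' (numbered 0 h) (s, size h) (t, (size h).+1) =
  next_distr sigma h s t.

Lemma keep_count_proof (sigma : strategy M) h x : history counter h x ->
  is_distr (counted x.2.+1 (sigma (map fst h) x.1)) (succs counter x).
Proof.
move=> /andP[hx xc]; have hx1 : history M (map fst h) x.1.
  by rewrite /history is_prefix_fst.
apply: sub_distr (counted_distr x.2.+1 (choice_distr sigma hx1)).
by move=> y /= [xy yx]; rewrite /succs /= /counted_step xy yx eqxx.
Qed.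

Definition keep_count (sigma : strategy M) : strategy counter :=
  Strategy (@keep_count_proof sigma).

Lemma corresponds_keep_count sigma : corresponds sigma (keep_count sigma).
Proof.
move=> h s t _; rewrite /next_distr /=.
have -> : ((s, size h) \in [pred x : S * nat | x.1 \in controlled M]) =
  (s \in controlled M) by [].
by case: ifP => _; rewrite /counted /= eqxx mul1r ?map_fst_numbered.
Qed.

Lemma forget_count_proof (sigma : strategy counter) h s : history M h s ->
  is_distr (fun t => sigma (numbered 0 h) (s, size h) (t, (size h).+1)) (succs M s).
Proof.
move=> /andP[hs sc].
have hc : history counter (numbered 0 h) (s, size h).
  by rewrite /history is_prefix_numbered.
have [q0 qD q1] := choice_distr sigma hc; split=> [//|t nt|].
  by apply: qD; rewrite /succs /= /counted_step /= => /andP[].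
rewrite -q1 (@esum_counted (size h).+1)// => y /negPf yn.
by rewrite qD// /succs /= /counted_step /= yn andbF.
Qed.

Definition forget_count (sigma : strategy counter) : strategy M :=
  Strategy (@forget_count_proof sigma).

Lemma corresponds_forget_count sigma : corresponds (forget_count sigma) sigma.
Proof.
move=> h s t _; rewrite /next_distr /=.
have -> : ((s, size h) \in [pred x : S * nat | x.1 \in controlled M]) =
  (s \in controlled M) by [].
by case: ifP => _ //; rewrite /counted /= eqxx mul1r.
Qed.

Lemma corresponds_path_prob sigma sigma' h s w : corresponds sigma sigma' ->
  is_prefix M h s ->
  path_prob sigma' (numbered 0 h) (s, size h) (numbered (size h).+1 w) =
  path_prob sigma h s w.
Proof.
move=> co; elim: w h s => //= t w IH h s hs.
rewrite [LHS]/= co//.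
have [->|nz] := eqVneq (next_distr sigma h s t) 0; first by rewrite !mul0r.
congr (_ * _); rewrite -IH; last exact: next_distr_step nz.
by rewrite numbered_rcons size_rcons.
Qed.

Lemma forget_proof s (r : run counter (s, 0%N)) i :
  step M (r i).1 (r i.+1).1.
Proof. by have /andP[] := run_step r i. Qed.

Lemma forget_start s (r : run counter (s, 0%N)) : (r 0%N).1 = s.
Proof. by rewrite run_start. Qed.

Definition forget s (r : run counter (s, 0%N)) : run M s :=
  @Run R S M s (fun i => (r i).1) (forget_start r) (forget_proof r).

(** The counter values are forced, so the preimage of a cylinder is a single cylinder. *)
Lemma preimage_forget s w : @forget s @^-1` cylinder (s :: w) =
  cylinder ((s, 0%N) :: numbered 1 w).
Proof.
have E (r : run counter (s, 0%N)) n : mkseq r n = numbered 0 (mkseq (forget r) n).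
  elim: n => //= n IH; rewrite !mkseqS numbered_rcons -IH size_mkseq.
  by congr rcons; rewrite [LHS]surjective_pairing run_counter.
apply/seteqP; split=> r; rewrite /cylinder /=; rewrite size_zip size_iota minnn.
  by move=> rw; rewrite E rw.
move=> rw; rewrite -[LHS](map_fst_numbered 0) -E rw /=.
by rewrite map_fst_numbered.
Qed.

Lemma measurable_forget s : measurable_fun setT (@forget s).
Proof.
apply: measurable_into_run => w; rewrite preimage_forget.
exact: measurable_cylinder.
Qed.

Lemma corresponds_law sigma sigma' s X : corresponds sigma sigma' ->
  measurable X ->
  run_law sigma s X = run_law sigma' (s, 0%N) (@forget s @^-1` X).
Proof.
move=> co mX.
apply: (finite_measure_unique (mu := run_law sigma s)
  (nu := measure_function_pushforward__canonical__measure_function_Measure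
    (run_law sigma' (s, 0%N)) (@measurable_forget s))) => //.
  by rewrite (@le_lt_trans _ _ 1%E) ?ltry// run_law_le1.
move=> w; rewrite /= /pushforward preimage_forget !run_lawP.
by rewrite -(corresponds_path_prob w co (h := [::])).
Qed.

(** * Transfer of optimal strategies between the MDP and its counted version *)

Section optimality.
Variables (A : nat -> set (S * S)) (s0 : S).
Hypothesis A_decreasing : forall i j, (i <= j)%N -> A j `<=` A i.

Let phi := \bigcap_i FG M s0 (A i).
Let A' i : set ((S * nat) * (S * nat)) := [set e | A i (e.1.1, e.2.1)].
Let phi' := \bigcap_i FG counter (s0, 0%N) (A' i).

Lemma corresponds_limit sigma sigma' : corresponds sigma sigma' ->
  run_law sigma s0 phi = run_law sigma' (s0, 0%N) phi'.
Proof.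
move=> co; rewrite (corresponds_law co)//.
rewrite /phi -event_limit; apply: measurable_phi.
exact: limit_event_approx.
Qed.

Lemma val_of_counter : val_of phi = val_of phi'.
Proof.
congr ereal_sup; apply/seteqP; split=> _ [sigma _ <-].
  by exists (keep_count sigma) => //; rewrite -(corresponds_limit (corresponds_keep_count sigma)).
by exists (forget_count sigma) => //; rewrite (corresponds_limit (corresponds_forget_count sigma)).
Qed.

(** A memoryless choice in [counter] depends on the state and the counter; after [forget_count] the
    counter is the length of the history, which makes the strategy Markov. *)
Lemma optimal_markov : (exists sigma : strategy M, optimal phi sigma) ->
  exists sigma : strategy M, [/\ optimal phi sigma, Markov sigma & deterministic sigma].
Proof.
move=> [sigma os].
have A'_decreasing i j : (i <= j)%N -> A' j `<=` A' i.
  by move=> ij e; exact: A_decreasing.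
have [|tau [tauP ot]] := transient_optimal_md A'_decreasing counter_transient
    (s := (s0, 0%N)).
  exists (keep_count sigma).
  by rewrite /optimal -/phi' -val_of_counter -(corresponds_limit (corresponds_keep_count sigma)).
exists (forget_count (md tauP)); split.
- by rewrite /optimal (corresponds_limit (corresponds_forget_count _)) val_of_counter.
- by move=> h h' s _ _ hh' u; rewrite /= hh'.
- move=> h s _; exists (tau (s, size h)).1 => u /=.
  have /andP[_] := tauP (s, size h); case: (tau _) => t m /= /eqP ->.
  by rewrite xpair_eqE eqxx andbT.
Qed.

End optimality.

End step_counter.

Theorem corollary28 (R : realType) (S : countType) (M : mdp R S) (s0 : S)
    (A : nat -> set (S * S))
    (A_transitions : forall i, A i `<=` transitions M)
    (A_decreasing : forall i j, (i <= j)%N -> A j `<=` A i)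
    (optimal_exists :
      exists sigma : strategy M, optimal (\bigcap_i FG M s0 (A i)) sigma) :
  (universally_transient M ->
    exists sigma : strategy M, [/\ optimal (\bigcap_i FG M s0 (A i)) sigma,
      memoryless sigma & deterministic sigma]) /\
  (exists sigma : strategy M, [/\ optimal (\bigcap_i FG M s0 (A i)) sigma,
      Markov sigma & deterministic sigma]).
Proof.
split=> [trans|]; last exact: optimal_markov.
have [tau [tauP ot]] := transient_optimal_md A_decreasing trans optimal_exists.
by exists (md tauP); split=> // h s _; exists (tau s).
Qed.
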